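(* Let $\mathbb{F}$ be an algebraically closed field of characteristic $0$. Let $f, u_0, u_1 \in \mathbb{F}[x_1,\ldots,x_n]$ be nonzero polynomials with $f = u_0 u_1$, and suppose $\mathrm{size}(f) + \mathrm{size}(u_0) \le s$. Then every polynomial factor $g$ of $u_1$ (i.e. every $g\in\mathbb{F}[x_1,\ldots,x_n]$ with $g \mid u_1$) can be computed by an algebraic circuit of size $\mathrm{poly}\big(s + \deg(\mathrm{rad}(u_1))\big)$, i.e. of size at most $(s+\deg(\mathrm{rad}(u_1)))^{c}$ for an absolute constant $c$.
   Context: An algebraic circuit over $\mathbb{F}$ is a directed acyclic graph whose leaves are labelled by variables $x_1,\dots,x_n$ or constants from $\mathbb{F}$ and whose internal nodes are addition and multiplication gates; it computes the polynomial at its output node. Its size is the number of nodes and edges. No bound on the degree of the computed polynomials is imposed (the degree may be exponential in the size). $\mathrm{size}(h)$ denotes the minimum size of an algebraic circuit computing $h$. For a polynomial $u = \prod_i h_i^{e_i}$ with $h_i$ pairwise coprime irreducible nonconstant polynomials and $e_i>0$, the radical is $\mathrm{rad}(u) := \prod_i h_i$. *)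

(* Defs.v *)
From HB Require Import structures.
From mathcomp Require Import all_boot all_order all_algebra.
From mathcomp Require Import boolp.
From mathcomp Require Import mpoly.

Set Implicit Arguments.
Unset Strict Implicit.
Unset Printing Implicit Defensive.

Import GRing.Theory.

Local Open Scope ring_scope.

(* The list of inputs of a gate may contain repetitions: parallel edges are   *)
(* allowed, and fan-in is unbounded.                                          *)
Inductive gate (F : Type) (n : nat) (V : Type) : Type :=
  | Var of 'I_n
  | Const of F
  | Add of seq V
  | Mul of seq V.

Arguments Var {F n V}.
Arguments Const {F n V}.
Arguments Add {F n V}.
Arguments Mul {F n V}.

Definition inputs (F : Type) (n : nat) (V : Type) (l : gate F n V) : seq V :=
  match l with
  | Var _ | Const _ => [::]
  | Add s | Mul s => s
  end.

Definition leaf (F : Type) (n : nat) (V : Type) (l : gate F n V) : bool :=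
  match l with
  | Var _ | Const _ => true
  | Add _ | Mul _ => false
  end.

Record circuit (F : Type) (n : nat) : Type := Circuit {
  node : finType;
  label : node -> gate F n node;
  output : node;
  inputs_neq0 : forall v, ~~ leaf (label v) -> inputs (label v) != [::];
  acyclic : forall p : seq node,
    cycle (fun v w => w \in inputs (label v)) p -> p = [::]
}.

Definition circuit_size (F : Type) (n : nat) (C : circuit F n) : nat :=
  (#|node C| + \sum_(v : node C) size (inputs (label v)))%N.

Section Semantics.

Variables (F : fieldType) (n : nat).

Definition gate_value (V : Type) (l : gate F n V) (val : V -> {mpoly F[n]}) :
    {mpoly F[n]} :=
  match l with
  | Var i => 'X_i
  | Const a => a%:MP
  | Add s => \sum_(w <- s) val w
  | Mul s => \prod_(w <- s) val w
  end.

(* By acyclicity such an assignment of polynomials to the nodes exists and is *)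
(* unique, see [valuation_exists] and [valuation_unique].                     *)
Definition valuation (C : circuit F n) (val : node C -> {mpoly F[n]}) : Prop :=
  forall v, val v = gate_value (label v) val.

Definition computes (C : circuit F n) (h : {mpoly F[n]}) : Prop :=
  exists2 val, valuation (C := C) val & val (output C) = h.

Lemma eq_gate_value (V : eqType) (l : gate F n V) (f g : V -> {mpoly F[n]}) :
  {in inputs l, f =1 g} -> gate_value l f = gate_value l g.
Proof.
case: l => //= s fg; rewrite big_seq [RHS]big_seq.
  by apply: eq_bigr => i /fg.
by apply: eq_bigr => i /fg.
Qed.

Section Valuation.

Variable C : circuit F n.

Let e (v w : node C) := w \in inputs (label v).
Let rank (v : node C) := #|connect e v|.

Lemma rank_lt v w : e v w -> (rank w < rank v)%N.
Proof.
move=> evw; apply: proper_card; apply/properP; split.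
  apply/fintype.subsetP => x cwx.
  exact: connect_trans (connect1 evw) cwx.
exists v; first exact: connect0.
apply/negP => /connectP[p wp vE].
suff : [:: w & p] = [::] by [].
by apply: (@acyclic _ _ C); rewrite /= rcons_path wp -vE.
Qed.

Lemma valuation_unique (f g : node C -> {mpoly F[n]}) :
  valuation f -> valuation g -> f =1 g.
Proof.
move=> fP gP v; have [k] := ubnP (rank v).
elim: k v => // k IHk v; rewrite ltnS => kv.
rewrite fP gP; apply: eq_gate_value => w evw; apply: IHk.
exact: leq_trans (rank_lt evw) kv.
Qed.

Lemma valuation_exists : exists f, valuation (C := C) f.
Proof.
pose step (f : node C -> {mpoly F[n]}) v := gate_value (label v) f.
have stable k v : (rank v <= k)%N ->
    iter k.+1 step (fun=> 0) v = iter k step (fun=> 0) v.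
  elim: k v => [|k IHk] v rv.
    have : (0 < rank v)%N.
      by apply/card_gt0P; exists v; exact: connect0.
    by rewrite ltnNge rv.
  apply: (@eq_gate_value _ (label v)) => w evw; apply: IHk.
  by rewrite -ltnS; apply: leq_trans (rank_lt evw) rv.
exists (iter #|node C| step (fun=> 0)) => v.
by rewrite -[LHS]stable ?max_card.
Qed.

End Valuation.

Lemma computes_exists (h : {mpoly F[n]}) : exists C, computes C h.
Proof.
pose K := size (msupp h); pose m (k : 'I_K) := nth 0%MM (msupp h) k.
pose V : finType := ('I_n + option 'I_K + 'I_K + unit)%type.
pose var i : V := inl (inl (inl i)).
pose cst k : V := inl (inl (inr k)).
pose mon k : V := inl (inr k).
pose vars k := flatten [seq nseq (m k i) (var i) | i <- enum 'I_n].
pose lab (v : V) : gate F n V :=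
  match v with
  | inl (inl (inl i)) => Var i
  | inl (inl (inr k)) => Const (if k is Some k then h@_(m k) else 0)
  | inl (inr k) => Mul (cst (Some k) :: vars k)
  | inr _ => Add (cst None :: [seq mon k | k <- enum 'I_K])
  end.
pose ht (v : V) : nat :=
  match v with inl (inl _) => 0 | inl (inr _) => 1 | inr _ => 2 end.
have ht_lt v w : w \in inputs (lab v) -> (ht w < ht v)%N.
  case: v => [[[i|k]|k]|u] //=; rewrite inE => /orP[/eqP->//|].
    by move=> /flatten_mapP[i _]; rewrite mem_nseq => /andP[_ /eqP->].
  by move=> /mapP[k _ ->].
have acyc p : cycle (fun v w => w \in inputs (lab v)) p -> p = [::].
  case: p => // x p /= xp; exfalso.
  have: path (relpre ht gtn) x (rcons p x).
    by apply: sub_path xp => v w /ht_lt.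
  rewrite path_sortedE; last by move=> y x' z /= h1 h2; apply: ltn_trans h2 h1.
  by rewrite all_rcons /= ltnn.
have inp v : ~~ leaf (lab v) -> inputs (lab v) != [::].
  by case: v => [[[i|k]|k]|u].
exists (@Circuit F n V lab (inr tt) inp acyc).
pose val (v : V) : {mpoly F[n]} :=
  match v with
  | inl (inl (inl i)) => 'X_i
  | inl (inl (inr k)) => (if k is Some k then h@_(m k) else 0)%:MP
  | inl (inr k) => h@_(m k) *: 'X_[m k]
  | inr _ => h
  end.
exists val => //; case=> [[[i|k]|k]|u] //=.
  rewrite big_cons big_flatten big_map -mul_mpolyC mpolyXE_id; congr (_ * _).
  by rewrite big_enum; apply: eq_bigr => i _; rewrite big_nseq -Monoid.iteropE.
rewrite big_cons big_map big_enum /= add0r {1}[h]mpolyE.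
by rewrite (big_nth 0%MM) big_mkord.
Qed.

Lemma size_exists (h : {mpoly F[n]}) :
  exists m, `[< exists2 C, computes C h & circuit_size C = m >].
Proof.
by have [C Ch] := computes_exists h; exists (circuit_size C); apply/asboolP; exists C.
Qed.

Definition poly_size (h : {mpoly F[n]}) : nat := ex_minn (size_exists h).

(* [msize] is the total degree plus one, and [msize 0 = 0]. *)
Definition deg (h : {mpoly F[n]}) : nat := (msize h).-1.

Definition mdvd (p q : {mpoly F[n]}) : Prop := exists r, q = p * r.

(* Units of the polynomial ring are the nonzero constants, so irreducible     *)
(* polynomials are in particular nonconstant.                                 *)
Definition mirreducible (p : {mpoly F[n]}) : Prop :=
  [/\ p != 0, p \isn't a GRing.unit &
      forall a b, p = a * b -> a \is a GRing.unit \/ b \is a GRing.unit].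

Definition mcoprime (p q : {mpoly F[n]}) : Prop :=
  forall d, mdvd d p -> mdvd d q -> d \is a GRing.unit.

(* The radical is only defined up to a nonzero scalar. The factor [a] is      *)
(* needed to cover nonzero constants, whose product of irreducibles is empty. *)
Definition is_radical (u r : {mpoly F[n]}) : Prop :=
  exists (k : nat) (h : 'I_k -> {mpoly F[n]}) (e : 'I_k -> nat) (a : F),
    [/\ a != 0 /\ u = a%:MP * \prod_(i < k) h i ^+ e i,
        forall i, mirreducible (h i),
        forall i, (0 < e i)%N,
        forall i j, i != j -> mcoprime (h i) (h j) &
        r = \prod_(i < k) h i].

Lemma munitP (p : {mpoly F[n]}) :
  reflect (exists2 a, a != 0 & p = a%:MP) (p \is a GRing.unit).
Proof.
apply: (iffP idP) => [|[a a0 ->]].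
  rewrite unfold_in /= => /andP[/eqP pE]; rewrite unitfE => p0.
  by exists p@_0.
by apply: rmorph_unit; rewrite unitfE.
Qed.

Lemma msize_gt1 (p : {mpoly F[n]}) :
  p != 0 -> p \isn't a GRing.unit -> (1 < msize p)%N.
Proof.
move=> p0 pu; rewrite ltnNge; apply: contra pu => /msize1_polyC pE.
by apply/munitP; exists p@_0 => //; apply: contraNneq p0 => E; rewrite pE E mpolyC0.
Qed.

Lemma msize_dvd_lt (a b : {mpoly F[n]}) :
  a != 0 -> b != 0 -> b \isn't a GRing.unit -> (msize a < msize (a * b))%N.
Proof.
move=> a0 b0 /(msize_gt1 b0) b1; rewrite msizeM //.
by case: (msize b) b1 => [|[|k]] // _; rewrite !addnS /= ltnS leq_addr.
Qed.

Lemma irreducible_divisor (u : {mpoly F[n]}) :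
  u != 0 -> u \isn't a GRing.unit -> exists2 p, mirreducible p & mdvd p u.
Proof.
have [k] := ubnP (msize u); elim: k u => // k IHk u uk u0 uu.
have [?|nirr] := pselect (mirreducible u).
  by exists u => //; exists 1; rewrite mulr1.
have [a [b [uE au bu]]] : exists a b,
    [/\ u = a * b, a \isn't a GRing.unit & b \isn't a GRing.unit].
  apply: contrapT => H; apply: nirr; split=> // a b uE.
  case: (boolP (a \is a GRing.unit)) => au; first by left.
  case: (boolP (b \is a GRing.unit)) => bu; first by right.
  by case: H; exists a, b.
have /andP[a0 b0] : (a != 0) && (b != 0) by rewrite -negb_or -mulf_eq0 -uE.
have ak : (msize a < k)%N.
  by apply: leq_trans (msize_dvd_lt a0 b0 bu) _; rewrite -uE -ltnS.
have [p pirr [q aE]] := IHk a ak a0 au.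
by exists p => //; exists (q * b); rewrite uE aE mulrA.
Qed.

Lemma irreducible_associate (p q : {mpoly F[n]}) :
  mirreducible p -> mirreducible q -> ~ mcoprime p q ->
  exists2 a, a != 0 & p = a%:MP * q.
Proof.
move=> [p0 pu pP] [q0 qu qP] /existsNP[d].
move=> /not_implyP[[p' pE]] /not_implyP[[q' qE]] du.
have [//|/munitP[a a0 p'E]] := pP _ _ pE.
have [//|/munitP[b b0 q'E]] := qP _ _ qE.
exists (a / b); first by rewrite mulf_neq0 ?invr_neq0.
rewrite pE qE p'E q'E mulrCA -mpolyCM.
by rewrite divfK.
Qed.

Lemma radical_exists (u : {mpoly F[n]}) : u != 0 -> exists r, is_radical u r.
Proof.
have [d] := ubnP (msize u); elim: d u => // d IHd u ud u0.
case: (boolP (u \is a GRing.unit)) => [/munitP[a a0 uE]|uu].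
  exists 1, 0%N, (fun=> 0), (fun=> 0%N), a.
  by split; rewrite ?big_ord0 ?mulr1 //; case.
have [p pirr [v uE]] := irreducible_divisor u0 uu.
have [p0 pu _] := pirr.
have v0 : v != 0 by apply: contraNneq u0 => v0; rewrite uE v0 mulr0.
have vd : (msize v < d)%N.
  by apply: leq_trans (msize_dvd_lt v0 p0 pu) _; rewrite mulrC -uE -ltnS.
have [r [k [h [e [a [[a0 vE] hirr e0 hcop rE]]]]]] := IHd v vd v0.
have [cop|] := pselect (forall i, mcoprime p (h i)).
  exists (p * r), k.+1, (fun i => if unlift ord0 i is Some j then h j else p),
    (fun i => if unlift ord0 i is Some j then e j else 1%N), a.
  split.
  - split=> //; rewrite big_ord_recl unlift_none expr1 mulrCA uE vE.
    by congr (_ * (_ * _)); apply: eq_bigr => i _; rewrite liftK.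
  - by move=> i; case: unliftP.
  - by move=> i; case: unliftP.
  - move=> i j; case: unliftP => [i' ->|->]; case: unliftP => [j' ->|->] //.
    + by rewrite (inj_eq lift_inj) => /hcop.
    + by move=> _ x xh xp; apply: cop xp xh.
  - rewrite big_ord_recl unlift_none rE; congr (_ * _).
    by apply: eq_bigr => i _; rewrite liftK.
move=> /existsNP[j /(irreducible_associate pirr (hirr j))[b b0 pE]].
exists r, k, h, (fun i => if i == j then (e i).+1 else e i), (b * a).
split=> //; last by move=> i; case: eqP.
split; first exact: mulf_neq0.
rewrite uE vE pE (bigD1 j) //= [in RHS](bigD1 j) //= eqxx exprS mpolyCM.
rewrite -!mulrA; congr (_ * _); rewrite [LHS]mulrCA; congr (_ * (_ * (_ * _))).
by apply: eq_bigr => i /negPf->.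
Qed.

End Semantics.

(* Main.v *)
Require Import Defs.
From mathcomp Require Import all_boot all_order all_algebra.
From mathcomp Require Import mpoly.
From mathcomp Require Import boolp zify ring.

Set Implicit Arguments.
Unset Strict Implicit.
Unset Printing Implicit Defensive.

Import GRing.Theory.
Import Pdiv.Idomain.

Local Open Scope ring_scope.

(* Write [u1 = lc * \prod_i h_i ^ e_i] with [h_i] irreducible and                 *)
(* [d = \sum_i deg h_i]. Substitute [x := al + be y + t (x - al)] for generic     *)
(* [al], [be]: at [t = 0] the [h_i] become pairwise coprime polynomials [g_i] in   *)
(* [y] of the same degrees, and at [t = 1], [y = 0] they are recovered. For [d]    *)
(* values [c] of [y], the power series [u1 = f / u0] in [t] is computed modulo     *)
(* [t^(d+1)] from the circuits of [f] and [u0]. If the coefficients of [t^j],      *)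
(* [j < k], of the [h_i] are known, then repeated squaring and a comparison of the *)
(* coefficients of [t^k] in [u1] give the values at the points [c] of              *)
(* [\sum_i e_i P_i / g_i], where [P_i] is the coefficient of [t^k] in [h_i]. As    *)
(* [deg P_i < deg g_i], these [d] values determine all the [P_i] linearly, by      *)
(* partial fractions. Finally, every divisor of [u1] is, up to a constant, a       *)
(* product of powers of the [h_i], with exponents at most exponential in [s].      *)

(** * Irreducible multivariate polynomials are prime *)

(** The exponents [e i] of the irreducible factors [h i] of [u1] may be exponential in the size, so
    the work has to depend on the radical only, whose degree is [d]. On the pencil, with [y] fixed
    at a good point, everything is a polynomial in [t], and truncation at [t^(d+1)] suffices: [u0]
    starts with a nonzero scalar, so [u1 = f / u0] is obtained to this order whatever its degree;
    every [h i] has degree at most [d], so nothing of it is lost; and [e i] occurs only as a scalar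
    and as an exponent for repeated squaring.

    The lifting from [t^k] to [t^(k+1)] is a first-order perturbation: by [coef_prod_expansion], the
    unknown coefficients [P_i] enter the coefficient of [t^k] in [u1] through the logarithmic
    derivative, the sum of the [e_i P_i / g_i]. In characteristic 0 no [e_i] vanishes, so
    [partial_fractions] recovers each [P_i] by linear combinations with coefficients in the field.

    A pencil with coprime [g_i] comes from [good_line]. It rests on Gauss's lemma: irreducible
    polynomials that are not associated stay coprime over a field of fractions, and a Bezout
    identity survives specialization at a generic point. Gauss's lemma also makes irreducibles
    prime, so that [divisor_prod_exp] describes all divisors of [u1]. Costs are counted with
    straight-line programs, exchanged with circuits by [cost_circuit] and [circuit_cost];
    [cost_divisor] assembles the whole. *)

Section Primes.

Variable R : idomainType.
Implicit Types (a b c p q : R).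

Definition rdvd p q := exists r, q = p * r.

Definition rirreducible p :=
  [/\ p != 0, p \isn't a GRing.unit &
      forall a b, p = a * b -> a \is a GRing.unit \/ b \is a GRing.unit].

Definition rprime p :=
  p != 0 /\ forall a b, rdvd p (a * b) -> rdvd p a \/ rdvd p b.

(** A unit times a product of primes. Required of all nonzero elements, this is factoriality in the
    form that lets denominators be cleared one prime at a time. *)
Inductive prime_factored : R -> Prop :=
| prime_factored_unit u : u \is a GRing.unit -> prime_factored u
| prime_factored_mul p c :
    rprime p -> prime_factored c -> prime_factored (p * c).

End Primes.

Section PolyPrimes.

Variable R : idomainType.
Implicit Types (c x y : R) (a b p q : {poly R}).

Lemma rdvd_polyC c p : rdvd c%:P p <-> forall i, rdvd c p`_i.
Proof.
split=> [[r ->] i|]; first by rewrite coefCM; exists r`_i.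
move=> /choice[r rP]; exists (\poly_(i < size p) r i).
apply/polyP=> i; rewrite coefCM coef_poly; case: ltnP => // le_i.
by rewrite mulr0 nth_default.
Qed.

(** If [c] divides neither [a] nor [b], let [a_i] and [b_j] be their lowest coefficients not
    divisible by [c]. In the coefficient of index [i + j] of [a * b] every other term is divisible
    by [c], hence so is [a_i * b_j], against primality. *)
Lemma rprime_polyC c : rprime c -> rprime c%:P.
Proof.
move=> [c0 cP]; split=> [|a b]; first by rewrite polyC_eq0.
move=> /rdvd_polyC dvd_ab; apply: contrapT => /not_orP[Na Nb].
have min_ndvd p : ~ rdvd c%:P p -> exists i,
    ~ rdvd c p`_i /\ forall k, (k < i)%N -> rdvd c p`_k.
  move=> /rdvd_polyC/existsNP Np.
  have ex : exists i, `[< ~ rdvd c p`_i >] by case: Np => i ?; exists i; apply/asboolP.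
  case: (ex_minnP ex) => i /asboolP Ni min_i; exists i; split=> // k lt_ki.
  by apply: contrapT => Nk; have := min_i k (asboolT Nk); rewrite leqNgt lt_ki.
have [i [Ni lt_i]] := min_ndvd _ Na; have [j [Nj lt_j]] := min_ndvd _ Nb.
have rdvdD u v : rdvd c u -> rdvd c v -> rdvd c (u + v).
  by move=> [r ->] [s ->]; exists (r + s); rewrite mulrDr.
suff : rdvd c (a`_i * b`_j) by case/cP.
have [r rE] := dvd_ab (i + j)%N; move: rE.
have lt_iij : (i < (i + j).+1)%N by rewrite ltnS leq_addr.
rewrite coefM (bigD1 (Ordinal lt_iij)) //= addKn => rE.
have {rE}-> : a`_i * b`_j = c * r -
    \sum_(k < (i + j).+1 | k != Ordinal lt_iij) a`_k * b`_(i + j - k).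
  by rewrite -rE addrK.
apply: (rdvdD); first by exists r.
rewrite -sumrN; apply: (big_ind (rdvd c)) => [|u v cu cv|k].
- by exists 0; rewrite mulr0.
- exact: rdvdD.
have -> : (k != Ordinal lt_iij) = (val k != i) by [].
rewrite neq_ltn => /orP[/lt_i[s ->]|lt_ik].
  by exists (- (s * b`_(i + j - k))); rewrite mulrN mulrA.
have [|s ->] := lt_j (i + j - k)%N.
  by rewrite ltn_subLR ?ltn_add2r // -ltnS ltn_ord.
by exists (- (a`_k * s)); rewrite mulrN mulrCA.
Qed.

(* Gauss's lemma: a denominator is distributed over the two factors. *)
Lemma polyC_cancel c p a b : prime_factored c -> c *: p = a * b ->
  exists x y a' b', [/\ a = x *: a', b = y *: b' & p = a' * b'].
Proof.
move=> cP; elim: cP p a b => {c} [u uU p a b pE|c c' [c0 cP] _ IHc p a b pE].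
  exists u, 1, (u^-1 *: a), b; split; rewrite ?scale1r //.
    by rewrite scalerA divrr // scale1r.
  by rewrite -scalerAl -pE scalerA mulVr // scale1r.
have cC0 : c%:P != 0 by rewrite polyC_eq0.
have [|[a1 aE]|[b1 bE]] := (rprime_polyC (conj c0 cP)).2 a b.
- by exists (c' *: p); rewrite mul_polyC scalerA.
- have [|x [y [a' [b' [a1E -> ->]]]]] := IHc p a1 b.
    by apply: (mulfI cC0); rewrite mulrA -aE -pE mul_polyC scalerA.
  exists (c * x), y, a', b'; split=> //.
  by rewrite aE a1E mul_polyC scalerA.
- have [|x [y [a' [b' [-> b1E ->]]]]] := IHc p a b1.
    by apply: (mulfI cC0); rewrite mulrCA -bE -pE mul_polyC scalerA.
  exists x, (c * y), a', b'; split=> //.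
  by rewrite bE b1E mul_polyC scalerA.
Qed.

Hypothesis factR : forall c, c != 0 -> prime_factored c.

(** Over a domain, [%|] allows a scalar denominator: it is divisibility over the field of fractions.
    Clearing the denominator by [polyC_cancel] produces a true factor of [p], whose cofactor must be
    a unit. *)
Lemma rirreducible_eqp p q :
  rirreducible p -> (1 < size q)%N -> q %| p -> q %= p.
Proof.
move=> [p0 _ pI] size_q /(@dvdpP R)[[c u] /= c0 pE].
have [x [y [a' [b' [uE qE p'E]]]]] := polyC_cancel (factR c0) pE.
have y0 : y != 0.
  by apply: contraTneq size_q => y0; rewrite qE y0 scale0r size_poly0.
have qb' : q %= b' by rewrite qE eqp_scale.
apply: (eqp_trans (qb')); rewrite p'E -{1}[b']mul1r eqp_mulr //.
have [|bU] := pI _ _ p'E.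
  by rewrite poly_unitE => /andP[]; rewrite size_poly_eq1 eqp_sym.
move: size_q; rewrite (eqp_size qb').
by move: bU; rewrite poly_unitE => /andP[/eqP-> _].
Qed.

Let size_gcdp_gt1 p q : p != 0 -> ~~ coprimep p q -> (1 < size (gcdp p q))%N.
Proof.
move=> p0; rewrite coprimep_def => /eqP.
have : gcdp p q != 0 by rewrite gcdp_eq0 negb_and p0.
by rewrite -size_poly_gt0; lia.
Qed.

Lemma rirreducible_coprimep p q :
  rirreducible p -> rirreducible q -> ~~ (p %= q) -> coprimep p q.
Proof.
move=> pI qI; apply: contraR; have [p0 _ _] := pI => /(size_gcdp_gt1 p0) size_g.
have gp := rirreducible_eqp pI size_g (dvdp_gcdl _ _).
have gq := rirreducible_eqp qI size_g (dvdp_gcdr _ _).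
by apply: eqp_trans gq; rewrite eqp_sym.
Qed.

Lemma rirreducible_prime_poly :
  (forall c : R, rirreducible c -> rprime c) ->
  forall p, rirreducible p -> rprime p.
Proof.
move=> primeR p pI; have [p0 pU pirr] := pI.
have [size_p|size_p] := leqP (size p) 1.
  have pE := size1_polyC size_p; rewrite pE; apply: rprime_polyC.
  apply: primeR; split.
  - by move: p0; rewrite {1}pE polyC_eq0.
  - by apply: contra pU => U; rewrite pE; apply: rmorph_unit.
  - move=> a b E; have [|U|U] := pirr a%:P b%:P; first by rewrite pE E polyCM.
      by left; move: U; rewrite poly_unitE coefC => /andP[].
    by right; move: U; rewrite poly_unitE coefC => /andP[].
split=> // a b [r abE].
(* Back from the field of fractions: in [p = y *: p'] either [y] is a unit, and can be moved to the
   cofactor, or [p'] is, and then [p] would be constant. *)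
have dvd_of u : p %| u -> rdvd p u.
  move=> /(@dvdpP R)[[c v] /= c0 uE].
  have [x [y [v' [p' [_ pE ->]]]]] := polyC_cancel (factR c0) uE.
  have [|U|U] := pirr y%:P p'; first by rewrite mul_polyC.
    exists (y^-1 *: v'); rewrite pE -scalerAl -scalerAr scalerA.
    by rewrite divrr ?scale1r 1?mulrC //; move: U; rewrite poly_unitE coefC => /andP[].
  move: U size_p; rewrite poly_unitE => /andP[/eqP sz _].
  by rewrite pE ltnNge (leq_trans (size_scale_leq _ _)) ?sz.
have dvd_ab : p %| a * b by rewrite abE dvdp_mulr.
case: (boolP (coprimep p a)) => [cop|Ncop].
  by right; apply: dvd_of; rewrite -(Gauss_dvdpr _ cop).
left; apply: dvd_of.
have size_g := size_gcdp_gt1 p0 Ncop.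
rewrite -(eqp_dvdl _ (rirreducible_eqp pI size_g (dvdp_gcdl _ _))).
exact: dvdp_gcdr.
Qed.

End PolyPrimes.

Lemma eq_mpoly_rmorph (F : comNzRingType) n (S : nzRingType)
    (phi psi : {rmorphism {mpoly F[n]} -> S}) :
  (forall c, phi c%:MP = psi c%:MP) -> (forall i, phi 'X_i = psi 'X_i) ->
  phi =1 psi.
Proof.
move=> eqC eqX p; rewrite [p]mpolyE !rmorph_sum; apply: eq_bigr => m _.
rewrite -mul_mpolyC !rmorphM eqC mpolyXE_id !rmorph_prod; congr (_ * _).
by apply: eq_bigr => i _; rewrite !rmorphXn eqX.
Qed.

(** * Isolating the last variable *)

Section MUniBij.

Variables (F : comNzRingType) (n : nat).

Lemma muni_lift (j : 'I_n) : muni 'X_(lift ord_max j) = ('X_j)%:P :> {poly {mpoly F[n]}}.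
Proof.
rewrite /muni mmapX mmap1U; case: splitP => [k|k] /= E.
  by congr ('X__)%:P; apply/val_inj; rewrite /= -E /= /bump leqNgt ltn_ord.
move: E; rewrite /bump leqNgt ltn_ord add0n => E.
by have := ltn_ord j; rewrite E ltnNge leq_addr.
Qed.

Lemma muni_ord_max : muni 'X_ord_max = 'X :> {poly {mpoly F[n]}}.
Proof.
rewrite /muni mmapX mmap1U; case: splitP => [k|k] //= E.
by have := ltn_ord k; rewrite -E ltnn.
Qed.

Let munimm : {rmorphism {poly {mpoly F[n]}} -> {mpoly F[n.+1]}} :=
  horner_eval ('X_ord_max) \o map_poly (@mwiden n F).

Let mwidenXU i : mwiden 'X_i = 'X_(lift ord_max i) :> {mpoly F[n.+1]}.
Proof.
rewrite mwidenX mnmwiden1; congr 'X_[mnm1 _]; apply/val_inj.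
by rewrite /= /bump leqNgt ltn_ord.
Qed.

Lemma muni_bij : bijective (@muni n F).
Proof.
exists munimm => p.
- apply: (@eq_mpoly_rmorph _ _ _ (munimm \o @muni n F) idfun) => [c|i] /=.
    by rewrite muniC map_polyC /horner_eval hornerC /= mwidenC.
  rewrite /horner_eval; case: (unliftP ord_max i) => [j|] ->.
    by rewrite muni_lift map_polyC hornerC /= mwidenXU.
  by rewrite muni_ord_max map_polyX hornerX.
- have muniw : @muni n F \o @mwiden n F =1 polyC.
    apply: (@eq_mpoly_rmorph _ _ _ (@muni n F \o @mwiden n F) polyC) => [c|i] /=.
      by rewrite mwidenC muniC.
    by rewrite mwidenXU muni_lift.
  elim/poly_ind: p => [|p c IHp]; first by rewrite !rmorph0.
  rewrite rmorphD rmorphM muniD muniM IHp /= /horner_eval map_polyX map_polyC.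
  rewrite hornerX hornerC muni_ord_max /=.
  by rewrite -[muni (mwiden c)]/((@muni n F \o @mwiden n F) c) muniw.
Qed.

End MUniBij.

(** * Induction on the number of variables *)

Section MPolyPrimes.

Variable F : fieldType.

Lemma rirreducible_prime_bij (R S : idomainType) (phi : {rmorphism R -> S}) :
  bijective phi -> (forall p : S, rirreducible p -> rprime p) ->
  forall p : R, rirreducible p -> rprime p.
Proof.
move=> [psi phiK psiK] primeS p [p0 pU pI].
have inj_phi := can_inj phiK.
have unit_phi x : phi x \is a GRing.unit -> x \is a GRing.unit.
  move=> /unitrP[y [yx xy]]; apply/unitrP; exists (psi y).
  by split; apply: inj_phi; rewrite rmorphM rmorph1 psiK.
have [|phip0 phiP] := primeS (phi p).
  split; first by rewrite -(rmorph0 phi) (inj_eq inj_phi).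
  - by apply: contra pU => /unit_phi.
  - move=> a b E; have [|U|U] := pI (psi a) (psi b).
    + by apply: inj_phi; rewrite rmorphM !psiK.
    + by left; rewrite -[a]psiK; apply: rmorph_unit.
    + by right; rewrite -[b]psiK; apply: rmorph_unit.
split=> // a b [r E]; have [|[u]|[u]] := phiP (phi a) (phi b).
- by exists (phi r); rewrite -!rmorphM E.
- by move=> uE; left; exists (psi u); apply: inj_phi; rewrite rmorphM psiK.
- by move=> uE; right; exists (psi u); apply: inj_phi; rewrite rmorphM psiK.
Qed.

Lemma mpoly_prime_factored n :
  (forall p : {mpoly F[n]}, rirreducible p -> rprime p) ->
  forall c : {mpoly F[n]}, c != 0 -> prime_factored c.
Proof.
move=> primeR c; have [k] := ubnP (msize c); elim: k c => // k IHk c ck c0.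
case: (boolP (c \is a GRing.unit)) => [|cU]; first exact: prime_factored_unit.
have [p pirr [v cE]] := irreducible_divisor c0 cU.
have [p0 pu _] := pirr.
have v0 : v != 0 by apply: contraNneq c0 => v0; rewrite cE v0 mulr0.
rewrite cE; apply: prime_factored_mul; first exact: primeR.
by apply: IHk => //; apply: leq_trans (msize_dvd_lt v0 p0 pu) _; rewrite mulrC -cE -ltnS.
Qed.

Lemma mirreducible_prime n (p : {mpoly F[n]}) : mirreducible p -> rprime p.
Proof.
elim: n p => [|n IHn] p.
  move=> [p0 pU _]; exfalso; move: pU; rewrite (nvar0_mpolyC p) => /negP[].
  apply/munitP; exists p@_0%MM => //; apply: contraNneq p0 => E.
  by rewrite (nvar0_mpolyC p) E mpolyC0.
apply: (@rirreducible_prime_bij _ _ (@muni n F) (@muni_bij F n)).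
exact: rirreducible_prime_poly (mpoly_prime_factored IHn) IHn.
Qed.

End MPolyPrimes.

(** * Straight-line programs *)

Section Cost.

Variables (F : fieldType) (n : nat).
Local Notation R := {mpoly F[n]}.
Implicit Types (A B S T : R -> Prop) (p q : R) (L : seq R).

Inductive step A : R -> Prop :=
| step_var i : step A 'X_i
| step_const a : step A a%:MP
| step_add p q : A p -> A q -> step A (p + q)
| step_mul p q : A p -> A q -> step A (p * q).

(* The most recently computed polynomial is the head of the list. *)
Fixpoint program A L : Prop :=
  if L is p :: L' then step (fun q => q \in L' \/ A q) p /\ program A L' else True.

(** The polynomials of [A] are free and those of [S] are to be computed together. Results are
    identified by their value and not by a position, so programs combine by mere concatenation. *)
Definition cost A S m :=
  exists L, [/\ (size L <= m)%N, program A L & forall p, S p -> p \in L \/ A p].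

Definition unionp A B p := A p \/ B p.

Definition bigunionp (S : nat -> R -> Prop) k p := exists2 i, (i < k)%N & S i p.

Lemma step_mono A B p : (forall q, A q -> B q) -> step A p -> step B p.
Proof.
move=> AB []; [exact: step_var|exact: step_const|..] => q r /AB Bq /AB Br.
  exact: step_add.
exact: step_mul.
Qed.

Lemma program_mono A B L : (forall q, A q -> B q) -> program A L -> program B L.
Proof.
move=> AB; elim: L => //= p L IHL [pP /IHL]; split=> //.
by apply: step_mono pP => q [|/AB]; [left|right].
Qed.

Lemma program_cat A L1 L2 :
  program A L1 -> program (fun p => p \in L1 \/ A p) L2 -> program A (L2 ++ L1).
Proof.
move=> P1; elim: L2 => //= p L2 IHL [pP /IHL]; split=> //.
by apply: step_mono pP => q [|[|]] H; rewrite mem_cat ?H ?orbT; auto.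
Qed.

Lemma cost_sub A S m : (forall p, S p -> A p) -> cost A S m.
Proof. by move=> SA; exists [::]; split=> // p /SA; right. Qed.

Lemma cost_mono A B S T m k : (forall p, A p -> B p) ->
  (forall p, T p -> S p) -> (m <= k)%N -> cost A S m -> cost B T k.
Proof.
move=> AB TS le_mk [L [Lm LP LS]]; exists L; split; first exact: leq_trans le_mk.
  exact: program_mono LP.
by move=> p /TS/LS[|/AB]; [left|right].
Qed.

Lemma cost_subr A S T m : (forall p, T p -> S p) -> cost A S m -> cost A T m.
Proof. by move=> TS; apply: cost_mono. Qed.

Lemma cost_leq A S m k : (m <= k)%N -> cost A S m -> cost A S k.
Proof. by move=> le_mk; apply: cost_mono. Qed.

Lemma cost_union A S T m k :
  cost A S m -> cost (unionp A S) T k -> cost A (unionp S T) (m + k).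
Proof.
move=> [L1 [L1m L1P L1S]] [L2 [L2k L2P L2T]]; exists (L2 ++ L1); split.
- by rewrite size_cat addnC leq_add.
- by apply: program_cat L1P _; apply: program_mono L2P => q [|/L1S] //; right.
- move=> p; rewrite mem_cat => -[/L1S[->|]|/L2T[->|[|/L1S[->|]]]];
    by rewrite ?orbT; auto.
Qed.

Lemma cost_trans A S T m k :
  cost A S m -> cost (unionp A S) T k -> cost A T (m + k).
Proof. by move=> AS /(cost_union AS); apply: cost_subr => p; right. Qed.

(** Stage [i] may use the results of all earlier stages, as recursions on coefficients require. *)
Lemma cost_bigunion A (S : nat -> R -> Prop) m k :
  (forall i, (i < k)%N -> cost (unionp A (bigunionp S i)) (S i) m) ->
  cost A (bigunionp S k) (k * m).
Proof.
elim: k => [_|k IHk SP]; first by apply: cost_sub => p [].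
rewrite mulSnr; apply: cost_subr (cost_union _ (SP k _)) => //; last first.
  by apply: IHk => i lt_ik; apply: SP; apply: ltnW.
move=> p [i]; rewrite ltnS leq_eqVlt => /predU1P[->|lt_ik] Sp; [by right|left].
by exists i.
Qed.

Lemma cost_bigunion_indep A (S : nat -> R -> Prop) m k :
  (forall i, (i < k)%N -> cost A (S i) m) -> cost A (bigunionp S k) (k * m).
Proof.
move=> SP; apply: cost_bigunion => i /SP; apply: cost_mono => // p Ap.
by left.
Qed.

Lemma cost_step A p : step A p -> cost A (eq p) 1.
Proof.
move=> pP; exists [:: p]; split=> //=.
  by split=> //; apply: step_mono pP; right.
by move=> q <-; left; rewrite mem_head.
Qed.

Lemma cost_const A a : cost A (eq a%:MP) 1.
Proof. exact/cost_step/step_const. Qed.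

Lemma cost_sum (T : eqType) A (s : seq T) (f : T -> R) :
  (forall w, w \in s -> A (f w)) -> cost A (eq (\sum_(w <- s) f w)) (size s).+1.
Proof.
elim: s => [_|w s IHs sA].
  by rewrite big_nil -[0]/(0 : R) -mpolyC0; apply: cost_const.
rewrite big_cons /= -addn1; apply: cost_trans (IHs _) _.
  by move=> v sv; apply: sA; rewrite inE sv orbT.
by apply/cost_step/step_add; [left; apply: sA; rewrite mem_head|right].
Qed.

Lemma cost_prod (T : eqType) A (s : seq T) (f : T -> R) :
  (forall w, w \in s -> A (f w)) -> cost A (eq (\prod_(w <- s) f w)) (size s).+1.
Proof.
elim: s => [_|w s IHs sA].
  by rewrite big_nil -mpolyC1; apply: cost_const.
rewrite big_cons /= -addn1; apply: cost_trans (IHs _) _.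
  by move=> v sv; apply: sA; rewrite inE sv orbT.
by apply/cost_step/step_mul; [left; apply: sA; rewrite mem_head|right].
Qed.

Lemma cost_sum_ord A k (f : nat -> R) :
  (forall i, (i < k)%N -> A (f i)) -> cost A (eq (\sum_(i < k) f i)) k.+1.
Proof.
move=> fA; rewrite -(big_mkord xpredT) /index_iota subn0.
rewrite -[k in k.+1](size_iota 0).
by apply: cost_sum => w; rewrite mem_iota; apply: fA.
Qed.

Lemma cost_scale A c p : A p -> cost A (eq (c *: p)) 2.
Proof.
move=> Ap; rewrite -mul_mpolyC; apply: (cost_trans (m := 1) (cost_const A c)).
by apply/cost_step/step_mul; [right|left].
Qed.

(** A gate of any fan-in is a chain of binary steps, one per input plus one for the neutral element
    or the leaf; the sum over all gates is the number of nodes and edges. *)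
Lemma cost_circuit (C : circuit F n) p :
  computes C p -> cost (fun=> False) (eq p) (circuit_size C).
Proof.
move=> [val valP <-].
have -> : circuit_size C =
    (\sum_(v in [set: node C]) (size (inputs (label v))).+1)%N.
  rewrite (eq_bigl xpredT) => [|v]; last by rewrite inE.
  under eq_bigr do rewrite -addn1.
  by rewrite big_split /= sum1_card addnC /circuit_size; congr (_ + _)%N; apply: eq_card.
pose rank (v : node C) := #|connect (fun v w => w \in inputs (label v)) v|.
suff H (D : {set node C}) :
    (forall v w, v \in D -> w \in inputs (label v) -> w \in D) ->
    cost (fun=> False) (fun q => exists2 v, v \in D & q = val v)
      (\sum_(v in D) (size (inputs (label v))).+1)%N.
  by apply: cost_subr (H setT _) => [q <-|v w]; [exists (output C)|]; rewrite ?inE.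
have [k] := ubnP #|D|; elim: k D => // k IHk D Dk Dcl.
have [->|[v0 v0D]] := set_0Vmem D.
  by apply: cost_sub => q [v]; rewrite inE.
(* The rank decreases strictly along edges, so a node of maximal rank is an input of no node of [D],
   and removing it leaves a set closed under inputs. *)
case: (arg_maxnP (fun v => rank v) v0D) => v vD vmax.
have D'cl u w : u \in D :\ v -> w \in inputs (label u) -> w \in D :\ v.
  rewrite !inE => /andP[uv uD] wu; rewrite (Dcl u) // andbT.
  apply: contraTneq wu => ->; apply/negP => /rank_lt; rewrite ltnNge.
  by apply/negP; rewrite negbK; apply: (vmax u uD).
have /IHk/(_ D'cl) IH : (#|D :\ v| < k)%N by move: Dk; rewrite (cardsD1 v D) (vD : v \in D).
rewrite (big_setD1 v) //= addnC.
apply: (@cost_subr _ (unionp (fun q => exists2 u, u \in D :\ v & q = val u)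
   (eq (val v)))).
  move=> q [u uD ->]; have [->|uv] := eqVneq u v; [by right|left].
  by exists u; rewrite // !inE uv.
apply: cost_union IH _; set B := unionp _ _.
have inpB w : w \in inputs (label v) -> B (val w).
  move=> wv; right; exists w => //; rewrite !inE (Dcl v) // andbT.
  by apply: contraTneq wv => ->; apply/negP => /rank_lt; rewrite ltnn.
rewrite valP; case: (label v) inpB => [i|a|s|s] /= sB.
- exact/cost_step/step_var.
- exact/cost_step/step_const.
- exact: cost_sum.
- exact: cost_prod.
Qed.

Lemma program_nth L : program (fun=> False) L -> forall i, (i < size L)%N ->
  step (fun q => exists2 j, (j < i)%N & q = nth 0 (rev L) j) (nth 0 (rev L) i).
Proof.
elim: L => //= p L IHL [pP /IHL {}IHL] i; rewrite ltnS leq_eqVlt.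
rewrite rev_cons nth_rcons size_rev => /predU1P[->|lt_i].
  rewrite ltnn eqxx; apply: step_mono pP => q [|//].
  rewrite -mem_rev => qL; exists (index q (rev L)).
    by rewrite -size_rev index_mem.
  by rewrite nth_rcons index_mem qL nth_index.
rewrite lt_i; apply: step_mono (IHL i lt_i) => q [j lt_j ->]; exists j => //.
by rewrite nth_rcons size_rev (ltn_trans lt_j lt_i).
Qed.

(** The nodes are the positions in the program. They refer to earlier positions only, which gives
    acyclicity, and each counts for itself and at most two edges. *)
Lemma circuit_cost p m : cost (fun=> False) (eq p) m ->
  exists2 C : circuit F n, computes C p & (circuit_size C <= 3 * m)%N.
Proof.
move=> [L [Lm LP /(_ _ erefl)[pL|//]]].
pose val (i : 'I_(size L)) := nth 0 (rev L) i.
have /choice[lab labP] : forall i : 'I_(size L), exists l : gate F n 'I_(size L),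
    [/\ val i = gate_value l val, forall w, w \in inputs l -> (w < i)%N,
        (size (inputs l) <= 2)%N & ~~ leaf l -> inputs l != [::]].
  move=> i; have sP : step (fun q => exists2 j, (j < i)%N & q = nth 0 (rev L) j) (val i).
    exact: program_nth.
  case: (val i) / sP => [j|a|q r|q r].
  - by exists (Var j).
  - by exists (Const a).
  - move=> [j lt_j ->] [k lt_k ->].
    exists (Add [:: Ordinal (ltn_trans lt_j (ltn_ord i));
                    Ordinal (ltn_trans lt_k (ltn_ord i))]).
    split=> //=; first by rewrite !big_cons big_nil addr0.
    by move=> w; rewrite !inE => /orP[] /eqP->.
  - move=> [j lt_j ->] [k lt_k ->].
    exists (Mul [:: Ordinal (ltn_trans lt_j (ltn_ord i));
                    Ordinal (ltn_trans lt_k (ltn_ord i))]).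
    split=> //=; first by rewrite !big_cons big_nil mulr1.
    by move=> w; rewrite !inE => /orP[] /eqP->.
have acyc s : cycle (fun v w => w \in inputs (lab v)) s -> s = [::].
  case: s => // x s /= xs; exfalso.
  have: path (fun v w : 'I_(size L) => (w < v)%N) x (rcons s x).
    by apply: sub_path xs => v w; case: (labP v) => _ H _ _ /H.
  rewrite path_sortedE; last by move=> y x' z /= h1 h2; apply: ltn_trans h2 h1.
  by rewrite all_rcons /= ltnn.
have inp v : ~~ leaf (lab v) -> inputs (lab v) != [::] by case: (labP v).
have lt_p : (index p (rev L) < size L)%N by rewrite -size_rev index_mem mem_rev.
exists (@Circuit F n 'I_(size L) lab (Ordinal lt_p) inp acyc).
  exists val => [v|]; first by case: (labP v).
  by rewrite /val /= nth_index // mem_rev.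
rewrite /circuit_size /= card_ord.
apply: (@leq_trans (size L + \sum_(v < size L) 2)%N).
  by rewrite leq_add2l; apply: leq_sum => v _; case: (labP v).
by rewrite sum_nat_const card_ord; lia.
Qed.

Lemma poly_size_cost p : cost (fun=> False) (eq p) (poly_size p).
Proof.
rewrite /poly_size; case: ex_minnP => m /asboolP[C Cp <-] _.
exact: cost_circuit.
Qed.

(** A step at most doubles the degree. This is what bounds the exponents of the irreducible
    factors. *)
Lemma msize_cost p m : cost (fun=> False) (eq p) m -> (msize p <= (2 ^ m).+1)%N.
Proof.
move=> [L [Lm LP /(_ _ erefl)[pL|//]]].
apply: (@leq_trans (2 ^ size L).+1); last by rewrite ltnS leq_pexp2l.
elim: L p {Lm} LP pL => //= q L IHL p [qP /IHL {}IHL].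
have two_gt0 : (0 < 2 ^ size L)%N by rewrite expn_gt0.
rewrite inE expnS => /predU1P[->|/IHL]; last by lia.
case: qP => [i|a|u v|u v].
- by rewrite msizeX mdeg1; lia.
- by rewrite msizeC; case: eqP => /= _; lia.
- move=> [/IHL Hu|//] [/IHL Hv|//]; apply: leq_trans (msizeD_le _ _) _.
  by rewrite geq_max; lia.
- move=> [/IHL Hu|//] [/IHL Hv|//].
  have [->|u0] := eqVneq u 0; first by rewrite mul0r msize0.
  have [->|v0] := eqVneq v 0; first by rewrite mulr0 msize0.
  by rewrite msizeM //; move: two_gt0 Hu Hv; move: (2 ^ _)%N (msize u) (msize v); lia.
Qed.

End Cost.

(** * Restriction to lines *)

Section Nonvanishing.

Variable F : fieldType.
Hypothesis pcharF0 : [pchar F] =i pred0.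

Lemma poly_nonroot (p : {poly F}) : p != 0 -> exists c, p.[c] != 0.
Proof.
move=> p0; apply: contrapT => /forallNP H.
have inj_nat : injective (fun i => i%:R : F).
  have /pcharf0P natF := pcharF0.
  move=> i j; wlog le_ij : i j / (i <= j)%N.
    by move=> W; case/orP: (leq_total i j) => [/W//|/W{}W /esym/W].
  move=> /eqP; rewrite eq_sym -subr_eq0 -natrB // natF subn_eq0 => le_ji.
  by apply/eqP; rewrite eqn_leq le_ij.
suff : (size [seq i%:R : F | i <- iota 0 (size p)] < size p)%N.
  by rewrite size_map size_iota ltnn.
apply: max_poly_roots => //; last by rewrite map_inj_uniq ?iota_uniq.
by apply/allP => c _; rewrite rootE; apply/negPn/negP/H.
Qed.

Lemma mpoly_nonroot n (p : {mpoly F[n]}) : p != 0 -> exists v, p.@[v] != 0.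
Proof.
elim: n p => [|n IHn] p p0.
  exists (fun=> 0); rewrite (nvar0_mpolyC p) mevalC.
  by apply: contraNneq p0 => E; rewrite (nvar0_mpolyC p) E mpolyC0.
have [v vP] : exists v, (lead_coef (muni p)).@[v] != 0.
  apply: IHn; rewrite lead_coef_eq0 -(rmorph0 (@muni n F)).
  by rewrite (inj_eq (bij_inj (@muni_bij F n))).
have [c cP] : exists c, (map_poly (meval v) (muni p)).[c] != 0.
  apply: poly_nonroot; apply: contraNneq vP => E.
  by rewrite lead_coefE -coef_map E coef0.
exists (fun i => if unlift ord_max i is Some j then v j else c).
move: cP; congr (_ != 0).
pose phi : {rmorphism {mpoly F[n.+1]} -> F} :=
  horner_eval c \o map_poly (meval v) \o @muni n F.
apply: (@eq_mpoly_rmorph _ _ _ phi (meval _)) => [a|i].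
  by rewrite /= /horner_eval muniC map_polyC hornerC /= !mevalC.
rewrite /= /horner_eval mevalXU; case: (unliftP ord_max i) => [j|] ->.
  by rewrite muni_lift map_polyC hornerC /= mevalXU.
by rewrite muni_ord_max map_polyX hornerX.
Qed.

End Nonvanishing.

Section Line.

Variables (F : fieldType) (n : nat) (A : comNzRingType) (iota : {rmorphism F -> A}).
Implicit Types (a b : 'I_n -> A) (p : {mpoly F[n]}).

(* The restriction [p (a + b y)], as a polynomial in [y]. *)
Definition line a b : {rmorphism {mpoly F[n]} -> {poly A}} :=
  mmap (polyC \o iota) (fun i => (a i)%:P + (b i)%:P * 'X).

Lemma lineC a b c : line a b c%:MP = (iota c)%:P.
Proof. exact: mmapC. Qed.

Lemma lineX a b i : line a b 'X_i = (a i)%:P + (b i)%:P * 'X.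
Proof. by rewrite /line /= mmapX mmap1U. Qed.

Let top (e : nat) (q : {poly A}) (c : A) := (size q <= e.+1)%N /\ q`_e = c.

Let topM e e' q q' c c' :
  top e q c -> top e' q' c' -> top (e + e') (q * q') (c * c').
Proof.
move=> [size_q <-] [size_q' <-]; split.
  by apply: leq_trans (size_polyMleq _ _) _; lia.
have lt_e : (e < (e + e').+1)%N by rewrite ltnS leq_addr.
rewrite coefM (bigD1 (Ordinal lt_e)) //= addKn big1 ?addr0 // => k.
have -> : (k != Ordinal lt_e) = (k != e :> nat) by [].
rewrite neq_ltn => /orP[lt_ke|lt_ek].
  by rewrite [q'`__]nth_default ?mulr0 //; apply: leq_trans size_q' _; lia.
by rewrite [q`__]nth_default ?mul0r //; apply: leq_trans size_q _; lia.
Qed.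

Let topX a b i k :
  top k (((a i)%:P + (b i)%:P * 'X) ^+ k) (b i ^+ k).
Proof.
elim: k => [|k IHk]; first by rewrite !expr0; split; rewrite ?size_poly1 ?coef1.
rewrite !exprS -add1n; apply: topM IHk; split; last first.
  by rewrite coefD coefC coefMX coefC /= add0r.
rewrite (leq_trans (size_polyD _ _)) // geq_max.
rewrite (leq_trans (size_polyC_leq1 _)) //=.
by rewrite (leq_trans (size_polyMleq _ _)) // size_polyX; have := size_polyC_leq1 (b i); lia.
Qed.

Let line_monomial a b m : top (mdeg m) (line a b 'X_[m]) (mmap1 b m).
Proof.
rewrite /line /= mmapX mdegE /mmap1.
elim/big_rec3 : _ => [|i e q c _ IH]; first by split; rewrite ?size_poly1 ?coef1.
exact: topM.
Qed.

(** The top coefficient sees only the direction [b], not the base point [a]: a direction on which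
    the leading form does not vanish preserves the degree on every parallel line. *)
Lemma line_top a b p e : (msize p <= e.+1)%N ->
  (size (line a b p) <= e.+1)%N /\ (line a b p)`_e = mmap iota b (pihomog mdeg e p).
Proof.
move=> size_p; have lineE : line a b p =
    \sum_(m <- msupp p) (iota p@_m)%:P * line a b 'X_[m].
  rewrite {1}[p]mpolyE rmorph_sum; apply: eq_bigr => m _.
  by rewrite -mul_mpolyC rmorphM lineC.
have degP m : m \in msupp p -> (mdeg m <= e)%N.
  by move=> /msize_mdeg_lt mp; rewrite -ltnS (leq_trans mp).
split.
  rewrite lineE; apply: (leq_trans (size_sum _ _ _)).
  apply/bigmax_leqP_seq => m /degP le_me _; have [sm _] := line_monomial a b m.
  rewrite mul_polyC (leq_trans (size_scale_leq _ _)) //.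
  by rewrite (leq_trans sm).
rewrite lineE coef_sum pihomogE rmorph_sum [RHS]big_mkcond /= !big_seq.
apply: eq_bigr => m /degP le_me; have [sm cm] := line_monomial a b m.
rewrite coefCM; case: eqP => [<-|/eqP ne].
  by rewrite cm mmapZ mmapX.
by rewrite nth_default ?mulr0 // (leq_trans sm) // ltn_neqAle ne.
Qed.

End Line.

Lemma pihomog_top_neq0 (F : fieldType) n (p : {mpoly F[n]}) :
  p != 0 -> pihomog mdeg (msize p).-1 p != 0.
Proof.
move=> p0; apply/negP => /eqP/(congr1 (mcoeff (mlead p))).
rewrite pihomogE mcoeff0 raddf_sum /= big_mkcond.
rewrite (bigD1_seq (mlead p)) ?msupp_uniq ?mlead_supp //=.
rewrite -mlead_deg //= eqxx mcoeffZ mcoeffX eqxx mulr1 big1 ?addr0 => [/eqP|m ne].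
  by rewrite mleadc_eq0 (negPf p0).
by case: eqP => // _; rewrite mcoeffZ mcoeffX (negPf ne) mulr0.
Qed.

Lemma eq_poly_rmorph (A B : nzRingType) (phi psi : {rmorphism {poly A} -> B}) :
  (forall c, phi c%:P = psi c%:P) -> phi 'X = psi 'X -> phi =1 psi.
Proof.
move=> eqC eqX p; elim/poly_ind: p => [|p c IHp]; first by rewrite !rmorph0.
by rewrite !rmorphD !rmorphM IHp eqC eqX.
Qed.

(** * Lines in general position *)

Section GenericLine.

Variables (F : fieldType) (n : nat).
Local Notation R := {mpoly F[n]}.
Implicit Types (b : 'I_n -> F) (p q : R) (P Q : {poly R}).

Definition translate b : {rmorphism R -> {poly R}} :=
  line (@mpolyC n F) (fun i => 'X_i) (fun i => (b i)%:MP).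

(** The endomorphism of [R[y]] that fixes [y] and sends [x] to [x + b y]. It extends [translate b],
    and the shear along [- b] is its inverse. *)
Let shear b : {rmorphism {poly R} -> {poly R}} :=
  horner_eval 'X \o map_poly (translate b).

Let translateC b c : translate b c%:MP = c%:MP%:P.
Proof. exact: lineC. Qed.

Let translateX b i : translate b 'X_i = ('X_i)%:P + (b i)%:MP%:P * 'X.
Proof. exact: lineX. Qed.

Let shearC b p : shear b p%:P = translate b p.
Proof. by rewrite /= /horner_eval map_polyC hornerC. Qed.

Let shearX b : shear b 'X = 'X.
Proof. by rewrite /= /horner_eval map_polyX hornerX. Qed.

Let shear_translate b b' p : (forall i, b i + b' i = 0) ->
  shear b' (translate b p) = p%:P.
Proof.
move=> bb'.
apply: (@eq_mpoly_rmorph _ _ _ (shear b' \o translate b) polyC) => [c|i].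
  by rewrite -[LHS]/(shear _ (translate b c%:MP)) translateC shearC translateC.
rewrite -[LHS]/(shear _ (translate b 'X_i)) translateX rmorphD rmorphM !shearC.
rewrite shearX translateC translateX -addrA -mulrDl -polyCD -mpolyCD addrC.
by rewrite [b' i + _]addrC bb' mpolyC0 polyC0 mul0r add0r.
Qed.

Let shearK b P : shear b (shear (fun i => - b i) P) = P.
Proof.
have K c : shear b (translate (fun i => - b i) c) = c%:P.
  by apply: shear_translate => i; rewrite addNr.
suff : shear b \o shear (fun i => - b i) =1 idfun by apply.
apply: eq_poly_rmorph => [c|].
  exact: etrans (congr1 (shear b) (shearC (fun i => - b i) c)) (K c).
exact: etrans (congr1 (shear b) (shearX (fun i => - b i))) (shearX b).
Qed.

(** The translate is the image of the constant [p%:P] under an automorphism. A factorization pulls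
    back to one of [p%:P], whose factors are constants, hence to one of [p]. *)
Lemma translate_irreducible b p : mirreducible p -> rirreducible (translate b p).
Proof.
move=> [p0 pU pI].
have shearP : shear (fun i => - b i) (translate b p) = p%:P.
  by apply: shear_translate => i; rewrite subrr.
split.
- apply: contraNneq p0 => E; move: shearP; rewrite E rmorph0 => /esym/eqP.
  by rewrite polyC_eq0.
- apply: contra pU => /(rmorph_unit (shear (fun i => - b i))).
  by rewrite shearP poly_unitE coefC => /andP[].
move=> P Q PQE; have PQ : shear (fun i => - b i) P * shear (fun i => - b i) Q = p%:P.
  by rewrite -rmorphM -PQE.
have : size (p%:P) == 1%N by rewrite size_polyC p0.
rewrite -PQ size_mul_eq1 => /andP[/size_poly1P[u u0 uE] /size_poly1P[v v0 vE]].
have puv : p = u * v by apply: polyC_inj; rewrite -PQ uE vE polyCM.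
have [U|U] := pI _ _ puv; [left|right].
  have -> : P = translate b u.
    exact: etrans (esym (shearK b P)) (etrans (congr1 (shear b) uE) (shearC b u)).
  exact: rmorph_unit.
have -> : Q = translate b v.
  exact: etrans (esym (shearK b Q)) (etrans (congr1 (shear b) vE) (shearC b v)).
exact: rmorph_unit.
Qed.

Lemma translate_at0 b p : (translate b p).[0] = p.
Proof.
apply: (@eq_mpoly_rmorph _ _ _ (horner_eval (0 : R) \o translate b) idfun) => [c|i].
  by rewrite -[LHS]/(horner_eval _ (translate b c%:MP)) translateC /horner_eval hornerC.
by rewrite -[LHS]/(horner_eval _ (translate b 'X_i)) translateX /horner_eval !hornerE.
Qed.

Let topv b p := (pihomog mdeg (msize p).-1 p).@[b].

Lemma lead_coef_translate b p : p != 0 -> topv b p != 0 ->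
  lead_coef (translate b p) = (topv b p)%:MP.
Proof.
move=> p0 pb.
have [|sp cp] := @line_top F n R (@mpolyC n F) (fun i => 'X_i) (fun i => (b i)%:MP)
  p (msize p).-1; first by rewrite -mpolySpred.
have cE : (translate b p)`_(msize p).-1 = (topv b p)%:MP.
  rewrite cp; apply: (@eq_mpoly_rmorph _ _ _ (mmap (@mpolyC n F) (fun i => (b i)%:MP))
    (@mpolyC n F \o meval b)) => [c|i] /=; first by rewrite mmapC mevalC.
  by rewrite mmapX mmap1U mevalXU.
rewrite lead_coefE -cE; congr (_`_ _).
have -> // : size (translate b p) = (msize p).-1.+1.
apply/eqP; rewrite eqn_leq sp /= ltnNge; apply: contra pb => le_s.
by rewrite -(mpolyC_eq0 n) -cE nth_default.
Qed.

(** The translates are irreducible in [R[y]] with scalar leading coefficients. Were they associated,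
    putting [y = 0] would make [p] and [q] proportional. So they are coprime over the fractions of
    [R], and the right-hand side [c] of a Bezout identity serves as a resultant: base points off its
    zeros are good. *)
Lemma line_coprime b p q : mirreducible p -> mirreducible q -> mcoprime p q ->
  topv b p != 0 -> topv b q != 0 ->
  exists2 c : R, c != 0 & forall a, c.@[a] != 0 ->
    coprimep (line idfun a b p) (line idfun a b q).
Proof.
move=> pI qI cop pb qb; have [p0 pU _] := pI; have [q0 _ _] := qI.
have factR := mpoly_prime_factored (@mirreducible_prime F n).
have mapE a r : map_poly (meval a) (translate b r) = line idfun a b r.
  apply: (@eq_mpoly_rmorph _ _ _ (map_poly (meval a) \o translate b)
    (line idfun a b)) => [x|i].
    by rewrite -[LHS]/(map_poly _ (translate b x%:MP)) translateC lineC map_polyC /= mevalC.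
  rewrite -[LHS]/(map_poly _ (translate b 'X_i)) translateX lineX rmorphD rmorphM /=.
  by rewrite map_polyX !map_polyC /= mevalXU mevalC.
have PI := translate_irreducible b pI; have QI := translate_irreducible b qI.
have leadP := lead_coef_translate p0 pb; have leadQ := lead_coef_translate q0 qb.
have P0 := translate_at0 b p; have Q0 := translate_at0 b q.
have mapP a := mapE a p; have mapQ a := mapE a q.
move: (translate b p : {poly R}) (translate b q : {poly R})
  PI QI leadP leadQ P0 Q0 mapP mapQ => P Q PI QI leadP leadQ P0 Q0 mapP mapQ.
have /Bezout_coprimepP[[u v] /=] : coprimep P Q.
  apply: (rirreducible_coprimep factR PI QI); apply/negP => /eqp_eq.
  rewrite leadP leadQ => /(congr1 (horner_eval 0)).
  rewrite /horner_eval !hornerZ P0 Q0 => E.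
  case/negP: pU; apply: (cop p); first by exists 1; rewrite mulr1.
  exists ((topv b q / topv b p)%:MP).
  apply: (@mulfI _ (topv b p)%:MP); first by rewrite mpolyC_eq0.
  by rewrite -E mulrCA -mpolyCM [_ * (_ / _)]mulrC divfK // mulrC.
rewrite -size_poly_eq1 => /size_poly1P[c c0 cE].
exists c => // a ca; apply/Bezout_coprimepP.
exists (map_poly (meval a) u, map_poly (meval a) v) => /=.
by rewrite -mapP -mapQ -!rmorphM -rmorphD cE /= map_polyC polyC_eqp1.
Qed.

Hypothesis pcharF0 : [pchar F] =i pred0.

(** The direction [b] comes first, off the zeros of the leading forms. The base point [a] then
    avoids the zeros of [f] and of the [c] of [line_coprime] for each pair, which depend on [b]. *)
Lemma good_line k (h : 'I_k -> R) (f : R) :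
  (forall i, mirreducible (h i)) ->
  (forall i j, i != j -> mcoprime (h i) (h j)) -> f != 0 ->
  exists a b, [/\ f.@[a] != 0,
    forall i, size (line idfun a b (h i)) = msize (h i) &
    forall i j, i != j -> coprimep (line idfun a b (h i)) (line idfun a b (h j))].
Proof.
move=> hI hcop f0; have h0 i : h i != 0 by case: (hI i).
have [b] : exists b, (\prod_i pihomog mdeg (msize (h i)).-1 (h i)).@[b] != 0.
  by apply: mpoly_nonroot => //; apply/prodf_neq0 => i _; apply: pihomog_top_neq0.
rewrite rmorph_prod => /prodf_neq0 hb.
have /choice[c cP] : forall ij : 'I_k * 'I_k, exists c : R, c != 0 /\
    forall a, c.@[a] != 0 -> ij.1 != ij.2 ->
      coprimep (line idfun a b (h ij.1)) (line idfun a b (h ij.2)).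
  move=> [i j] /=; have [->|ne] := eqVneq i j.
    by exists 1; split=> [|//]; rewrite oner_eq0.
  have [c c0 cP] := line_coprime (hI i) (hI j) (hcop _ _ ne) (hb i isT) (hb j isT).
  by exists c; split=> // a ca _; apply: cP.
have [a] : exists a, (f * \prod_ij c ij).@[a] != 0.
  apply: mpoly_nonroot => //; rewrite mulf_neq0 //.
  by apply/prodf_neq0 => ij _; case: (cP ij).
rewrite rmorphM rmorph_prod mulf_eq0 negb_or => /andP[fa /prodf_neq0 ca].
exists a, b; split=> // [i|i j ne]; last first.
  by case: (cP (i, j)) => _; apply=> //; apply: ca.
have [|si ci] := @line_top F n F idfun a b (h i) (msize (h i)).-1.
  by rewrite -mpolySpred.
rewrite -mpolySpred // in si.
apply/eqP; rewrite eqn_leq si /= mpolySpred // ltnNge; apply/negP => le_s.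
by move: ci; rewrite nth_default // => /esym/eqP; apply/negP; apply: hb.
Qed.

End GenericLine.

(** * Partial fractions *)

Lemma size_prod_leqS (A : nzRingType) (I : finType) (P : pred I)
    (g : I -> {poly A}) (D : I -> nat) :
  (forall i, (size (g i) <= (D i).+1)%N) ->
  (size (\prod_(i | P i) g i)%R <= (\sum_(i | P i) D i).+1)%N.
Proof.
move=> gD; elim/big_rec2: _ => [|i m p _ IH]; first by rewrite size_poly1.
by apply: leq_trans (size_polyMleq _ _) _; have := gD i; lia.
Qed.

Lemma lagrange_basis (F : fieldType) d (c : 'I_d -> F) : injective c ->
  exists L : 'I_d -> {poly F},
    (forall l, (size (L l) <= d)%N) /\ forall l m, (L l).[c m] = (l == m)%:R.
Proof.
move=> c_inj.
pose M l := \prod_(m | m != l) ('X - (c m)%:P).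
have ME l m : (M l).[c m] = \prod_(j | j != l) (c m - c j).
  by rewrite horner_prod; apply: eq_bigr => j _; rewrite !hornerE.
exists (fun l => (M l).[c l]^-1 *: M l); split=> [l|l m].
  apply: leq_trans (size_scale_leq _ _) _.
  apply: leq_trans (size_prod_leqS (D := fun=> 1%N) _ _) _.
    by move=> i; rewrite size_XsubC.
  by rewrite sum1_card cardC1 card_ord; case: d l {c c_inj M ME} => [[]|].
rewrite hornerZ; have [<-|ne] := eqVneq.
  rewrite mulVf // ME; apply/prodf_neq0 => j ne.
  by rewrite subr_eq0 (inj_eq c_inj) eq_sym.
by rewrite [(M l).[c m]]ME (bigD1 m) 1?eq_sym //= subrr mul0r mulr0.
Qed.

Section PartialFractions.

Variables (F : fieldType) (R : idomainType) (iota : {rmorphism F -> R}).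
Variables (k d : nat) (g : 'I_k -> {poly F}) (D : 'I_k -> nat) (eps : 'I_k -> F).
Variable c : 'I_d -> F.
Hypotheses (size_g : forall i, size (g i) = (D i).+1)
  (sum_D : (\sum_i D i)%N = d)
  (coprime_g : forall i j, i != j -> coprimep (g i) (g j))
  (eps_neq0 : forall i, eps i != 0)
  (c_inj : injective c)
  (g_neq0 : forall i l, (g i).[c l] != 0).

(** Over the common denominator, the given sums are values of a numerator of degree less than [d],
    which interpolation recovers; inverting the other [g j] modulo [g i] then isolates [P i]. The
    weights [lam] are chosen before [P], so they are constants for a program that computes with the
    values of [P]. *)
Lemma partial_fractions i c' : exists lam : 'I_d -> F,
  forall P : 'I_k -> {poly R}, (forall j, (size (P j) <= D j)%N) ->
  (P i).[iota c'] = \sum_l iota (lam l) *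
    \sum_j iota (eps j / (g j).[c l]) * (P j).[iota (c l)].
Proof.
have [L [size_L LP]] := lagrange_basis c_inj.
pose others j := \prod_(m | m != j) g m.
have /Bezout_eq1_coprimepP[[u v] /= uvE] : coprimep (g i) (others i).
  by apply: (big_ind (coprimep (g i))) => [|p q cp cq|j /coprime_g];
    rewrite ?coprimep1 ?coprimepMr ?cp // coprimep_sym.
(* Modulo [g i], [v] inverts the product of the other [g j], so [rho l] is the share of the Lagrange
   polynomial [L l] in [eps i *: P i]. *)
pose rho l := (L l * v) %% g i.
exists (fun l => (eps i)^-1 * (rho l).[c'] * \prod_m (g m).[c l]) => P size_P.
pose map := map_poly iota.
have map_horner p x : (map p).[iota x] = iota p.[x] by rewrite horner_map.
(* [N] has degree less than [d], hence is interpolated from its values, and *)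
(* [N * v] is [eps i * P i] modulo [g i].                                    *)
pose N := \sum_j iota (eps j) *: (P j * map (others j)).
have size_N : (size N <= d)%N.
  apply: leq_trans (size_sum _ _ _) _; apply/bigmax_leqP => j _.
  apply: leq_trans (size_scale_leq _ _) _.
  apply: leq_trans (size_polyMleq _ _) _; rewrite size_map_poly -sum_D (bigD1 j) //=.
  have : (size (others j) <= (\sum_(m | m != j) D m).+1)%N.
    by apply: size_prod_leqS => m; rewrite size_g.
  have := size_P j; move: (size (P j)) (size (others j)) (\sum_(m | m != j) D m)%N.
  by move=> x y z; lia.
have N_at l : N.[iota (c l)] = iota (\prod_m (g m).[c l]) *
    \sum_j iota (eps j / (g j).[c l]) * (P j).[iota (c l)].
  rewrite horner_sum mulr_sumr; apply: eq_bigr => j _.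
  rewrite hornerZ hornerM map_horner horner_prod [in RHS](bigD1 j) //= mulrA -rmorphM.
  rewrite (_ : _ * _ * (eps j / _) = eps j * \prod_(m | m != j) (g m).[c l]).
    by rewrite rmorphM -mulrA [(P j).[_] * _]mulrC.
  by field; apply: g_neq0.
have [S SE] : exists S, N * map v = iota (eps i) *: P i + map (g i) * S.
  rewrite /N (bigD1 i) //= mulrDl.
  have [S' ->] : exists S', (\sum_(j | j != i) iota (eps j) *: (P j * map (others j))) * map v
      = map (g i) * S'.
    rewrite mulr_suml; apply: (big_ind (fun x => exists S', x = map (g i) * S')).
    - by exists 0; rewrite mulr0.
    - by move=> _ _ [x ->] [y ->]; exists (x + y); rewrite mulrDr.
    move=> j ne; rewrite /others (bigD1 i) 1?eq_sym //= /map rmorphM /=.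
    rewrite -mul_polyC; move: (map_poly iota (\prod_(_ | _) _)) => o.
    by exists ((iota (eps j))%:P * P j * o * map v); rewrite /map; ring.
  exists (S' - iota (eps i) *: (P i * map u)).
  have vE : map (others i) * map v = 1 - map u * map (g i).
    by rewrite /map -!rmorphM mulrC -(rmorph1 (map_poly iota)) -uvE rmorphD addrAC subrr add0r.
  by rewrite -scalerAl -mulrA vE -!mul_polyC; ring.
clearbody N.
have NE : N = \sum_l N.[iota (c l)] *: map (L l).
  apply/eqP; rewrite -subr_eq0; apply/eqP.
  apply: (@roots_geq_poly_eq0 _ _ [seq iota (c l) | l : 'I_d]).
  - apply/allP => _ /mapP[m _ ->]; rewrite rootE hornerD hornerN horner_sum (bigD1 m) //=.
    rewrite hornerZ map_horner LP eqxx rmorph1 mulr1 big1 ?addr0 ?subrr // => l ne.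
    by rewrite hornerZ map_horner LP (negPf ne) rmorph0 mulr0.
  - by rewrite map_inj_uniq ?enum_uniq // => l m /(fmorph_inj iota)/c_inj.
  - rewrite size_map size_enum_ord (leq_trans (size_polyD _ _)) // geq_max size_N size_polyN.
    apply: leq_trans (size_sum _ _ _) _; apply/bigmax_leqP => l _.
    by rewrite (leq_trans (size_scale_leq _ _)) // size_map_poly size_L.
have {}SE : map (g i) * S + iota (eps i) *: P i = N * map v by rewrite SE addrC.
have [T TE] : exists T, N * map v =
    \sum_l N.[iota (c l)] *: map (rho l) + map (g i) * T.
  exists (\sum_l N.[iota (c l)] *: map (L l * v %/ g i)).
  rewrite {1}NE mulr_suml mulr_sumr -big_split; apply: eq_bigr => l _ /=.
  rewrite -scalerAl -scalerAr -scalerDr; congr (_ *: _).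
  by rewrite /map -!rmorphM -rmorphD {1}(Pdiv.Field.divp_eq (L l * v) (g i)) mulrC addrC.
have g0 : map (g i) != 0 by rewrite map_poly_eq0 -size_poly_eq0 size_g.
(* Both sides are congruent modulo [g i] and of smaller degree than [g i]. *)
have PE : iota (eps i) *: P i = \sum_l N.[iota (c l)] *: map (rho l).
  apply/eqP; rewrite -subr_eq0; apply: contraT => ne.
  have E : map (g i) * (T - S) =
      iota (eps i) *: P i - \sum_l N.[iota (c l)] *: map (rho l).
    by rewrite mulrBr; apply/eqP; rewrite subr_eq addrAC eq_sym subr_eq addrC SE TE addrC.
  have : (size (g i) <= size (map (g i) * (T - S))%R)%N.
    have TS : T - S != 0 by apply: contraNneq ne => TS; rewrite -E TS mulr0.
    by rewrite size_mul // size_map_poly; move: TS; rewrite -size_poly_gt0; lia.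
  rewrite E leqNgt size_g ltnS (leq_trans (size_polyD _ _)) // geq_max size_polyN.
  rewrite (leq_trans (size_scale_leq _ _)) //=.
  apply: leq_trans (size_sum _ _ _) _; apply/bigmax_leqP => l _.
  rewrite (leq_trans (size_scale_leq _ _)) // size_map_poly -ltnS -size_g.
  by rewrite ltn_modp -size_poly_eq0 size_g.
have -> : P i = iota (eps i)^-1 *: \sum_l N.[iota (c l)] *: map (rho l).
  by rewrite -PE scalerA -rmorphM mulVf // rmorph1 scale1r.
rewrite hornerZ horner_sum mulr_sumr; apply: eq_bigr => l _.
rewrite hornerZ map_horner N_at !rmorphM /=.
by ring.
Qed.

End PartialFractions.

(** * Truncated power series *)

Section SeriesCost.

Variables (F : fieldType) (n : nat).
Local Notation R := {mpoly F[n]}.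
Implicit Types (A S : R -> Prop) (u v : {poly R}).

Lemma cost_exists (I : finType) A (S : I -> R -> Prop) m :
  (forall i, cost A (S i) m) -> cost A (fun p => exists i, S i p) (#|I| * m).
Proof.
move=> SP; pose S' j p := exists2 i, (enum_rank i : nat) = j & S i p.
apply: cost_subr (_ : cost A (bigunionp S' #|I|) _).
  by move=> p [i Sp]; exists (enum_rank i) => //; exists i.
apply: cost_bigunion_indep => j lt_j; apply: cost_subr (SP (enum_val (Ordinal lt_j))).
by move=> p [i iE]; rewrite (_ : Ordinal _ = enum_rank i) ?enum_rankK //; apply/val_inj.
Qed.

Lemma cost_exists_ord k A (S : 'I_k -> R -> Prop) m :
  (forall i, cost A (S i) m) -> cost A (fun p => exists i, S i p) (k * m).
Proof. by move=> /cost_exists; rewrite card_ord. Qed.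

Lemma cost_lincomb k A (c : 'I_k -> F) (f : 'I_k -> R) :
  (forall i, A (f i)) -> cost A (eq (\sum_i c i *: f i)) (3 * k).+1.
Proof.
move=> fA; have -> : (3 * k).+1 = (k * 2 + k.+1)%N by lia.
apply: (cost_trans (S := fun p => exists i, eq (c i *: f i) p)).
  by apply: cost_exists_ord => i; apply: cost_scale.
rewrite -big_enum /= -[X in cost _ _ X.+1](size_enum_ord k).
by apply: cost_sum => i _; right; exists i.
Qed.

Lemma cost_lin2 A (a b : F) (p q : R) : A p -> A q ->
  cost A (eq (a *: p + b *: q)) 5.
Proof.
move=> Ap Aq; have -> : 5%N = (2 + (2 + 1))%N by [].
apply: cost_trans (cost_scale a Ap) _.
apply: cost_trans (@cost_scale _ _ _ b q _) _; first by left.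
by apply/cost_step/step_add; [left; right|right].
Qed.

Definition ser D u := bigunionp (fun k => eq u`_k) D.

Variable D : nat.
Let K := (D * (3 * D))%N.

Lemma cost_ser_mul A u v : (forall p, ser D u p -> A p) ->
  (forall p, ser D v p -> A p) -> cost A (ser D (u * v)) K.
Proof.
move=> uA vA; apply: cost_bigunion_indep => k lt_k.
apply: (@cost_leq _ _ _ _ (k.+1 * 1 + k.+2)); first by lia.
rewrite coefM; apply: (cost_trans (S := bigunionp (fun j => eq (u`_j * v`_(k - j))) k.+1)).
  apply: cost_bigunion_indep => j lt_j; apply/cost_step/step_mul.
    by apply: uA; exists j => //; apply: leq_trans lt_k.
  by apply: vA; exists (k - j)%N => //; apply: leq_ltn_trans lt_k; apply: leq_subr.
by apply: (@cost_sum_ord _ _ _ k.+1 (fun j => u`_j * v`_(k - j))) => j lt_j; right; exists j.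
Qed.

Lemma cost_ser_add A u v : (forall p, ser D u p -> A p) ->
  (forall p, ser D v p -> A p) -> cost A (ser D (u + v)) D.
Proof.
move=> uA vA; rewrite -[D in X in cost _ _ X]muln1; apply: cost_bigunion_indep => k lt_k.
by rewrite coefD; apply/cost_step/step_add; [apply: uA|apply: vA]; exists k.
Qed.

Lemma cost_ser_const A (c : F) : cost A (ser D c%:MP%:P) D.
Proof.
rewrite -[D in X in cost _ _ X]muln1; apply: cost_bigunion_indep => k lt_k.
by rewrite coefC; case: eqP => _; rewrite -?[0]/(0 : R) -?(mpolyC0 n F); apply: cost_const.
Qed.

Let leDK : (D <= K)%N.
Proof. by rewrite /K; case: D => // D'; nia. Qed.

Lemma cost_ser_one A : cost A (ser D 1) K.
Proof. by apply: cost_leq leDK _; rewrite -polyC1 -mpolyC1; apply: cost_ser_const. Qed.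

Lemma cost_ser_exp A u e m : (e < 2 ^ m)%N -> (forall p, ser D u p -> A p) ->
  cost A (ser D (u ^+ e)) ((2 * m).+1 * K).
Proof.
move=> lt_e uA; elim: m e lt_e => [|m IHm] e lt_e.
  by move: lt_e; rewrite expn0 ltnS leqn0 => /eqP->; rewrite mul1n; apply: cost_ser_one.
have -> : ((2 * m.+1).+1 * K = (2 * m).+1 * K + (K + K))%N by lia.
apply: cost_trans (IHm e./2 _) _.
  by rewrite ltn_half_double -mul2n -expnS.
have -> : u ^+ e = u ^+ odd e * (u ^+ e./2 * u ^+ e./2).
  by rewrite -!exprD addnn odd_double_half.
apply: (cost_trans (S := ser D (u ^+ e./2 * u ^+ e./2))).
  by apply: cost_ser_mul => p; right.
case: (odd e); last first.
  by rewrite expr0 mul1r; apply: cost_sub => p; right.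
by rewrite expr1; apply: cost_ser_mul => p Hp; [left; left; apply: uA|right].
Qed.

Lemma cost_ser_prod k A (u : 'I_k -> {poly R}) :
  (forall i p, ser D (u i) p -> A p) -> cost A (ser D (\prod_i u i)) (k.+1 * K).
Proof.
move=> uA; rewrite -big_enum /= -[X in cost _ _ (X.+1 * _)](size_enum_ord k).
elim: (enum 'I_k) => [|i s IHs].
  by rewrite big_nil mul1n; apply: cost_ser_one.
rewrite big_cons /= mulSn addnC; apply: cost_trans IHs _.
by apply: cost_ser_mul => p Hp; [left; apply: (uA i)|right].
Qed.

(** Division of power series: each coefficient of [v] follows from that of [u * v] and the earlier
    ones of [v], with [a] as the only divisor. *)
Lemma cost_ser_div A u v (a : F) : a != 0 -> u`_0 = a%:MP ->
  (forall p, ser D u p -> A p) -> (forall p, ser D (u * v) p -> A p) ->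
  cost A (ser D v) (2 * K).
Proof.
move=> a0 u0 uA uvA; rewrite /K mulnCA; apply: cost_bigunion => k lt_k.
set B := unionp _ _.
pose s := \sum_(j < k) u`_j.+1 * v`_(k - j.+1).
have -> : v`_k = a^-1 *: (u * v)`_k + (- a^-1) *: s.
  rewrite coefM big_ord_recl u0 subn0 -/s scalerDr scaleNr mul_mpolyC scalerA mulVf //.
  by rewrite scale1r addrK.
apply: (@cost_leq _ _ _ _ ((k * 1 + k.+1) + 5)); first by nia.
apply: (cost_trans (S := eq s)).
  apply: (cost_trans (S := bigunionp (fun j => eq (u`_j.+1 * v`_(k - j.+1))) k)).
    apply: cost_bigunion_indep => j lt_j; apply/cost_step/step_mul.
      by left; apply: uA; exists j.+1 => //; apply: leq_ltn_trans lt_k.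
    by right; exists (k - j.+1)%N => //; rewrite ltn_subrL; case: (k) lt_j.
  apply: (@cost_sum_ord _ _ _ k (fun j => u`_j.+1 * v`_(k - j.+1))) => j lt_j.
  by right; exists j.
by apply: cost_lin2; [left; left; apply: uvA; exists k|right].
Qed.

(** The program for [p] is run on truncated series, at most [K] operations replacing each step. *)
Lemma cost_ser_rmorph (phi : {rmorphism R -> {poly R}}) p m :
  (forall A i, cost A (ser D (phi 'X_i)) K) ->
  (forall c, phi c%:MP = c%:MP%:P) ->
  cost (fun=> False) (eq p) m -> cost (fun=> False) (ser D (phi p)) (m * K).
Proof.
move=> phiX phiC [L [Lm LP /(_ _ erefl)[pL|//]]].
apply: (@cost_leq _ _ _ _ (size L * K)); first by rewrite leq_mul2r Lm orbT.
apply: (@cost_subr _ _ _ (fun q => exists2 r, r \in L & ser D (phi r) q)).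
  by move=> q; exists p.
elim: L LP {pL Lm} => [_|q L IHL] /=; first by apply: cost_sub => r [].
move=> [qP /IHL {}IHL]; rewrite mulSnr; pose S q := exists2 r, r \in L & ser D (phi r) q.
apply: (@cost_subr _ _ _ (unionp S (ser D (phi q)))).
  move=> r [w]; rewrite inE => /predU1P[->|wL]; [by right|left].
  by exists w.
apply: (@cost_union _ _ _ S) IHL _; case: qP => [i|a|v w|v w].
- exact: phiX.
- by rewrite phiC; apply: cost_leq leDK _; apply: cost_ser_const.
- move=> [vL|//] [wL|//]; rewrite rmorphD; apply: cost_leq leDK _.
  by apply: cost_ser_add => r Hr; right; [exists v|exists w].
- move=> [vL|//] [wL|//]; rewrite rmorphM.
  by apply: cost_ser_mul => r Hr; right; [exists v|exists w].
Qed.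

End SeriesCost.

Lemma cost_exp_prod (F : fieldType) n k (A : {mpoly F[n]} -> Prop)
    (h : 'I_k -> {mpoly F[n]}) (e : 'I_k -> nat) m :
  (forall i, (e i < 2 ^ m)%N) -> (forall i, A (h i)) ->
  cost A (eq (\prod_i h i ^+ e i)) (k * ((2 * m).+1 * 3) + k.+1 * 3).
Proof.
move=> em hA.
(* Series of length 1 are just polynomials, so the bounds for powers and products of series apply
   with [K = 3]. *)
have serC (p q : {mpoly F[n]}) : ser 1 p%:P q -> p = q.
  by move=> [j]; rewrite ltnS leqn0 => /eqP->; rewrite coefC.
pose S := fun q => exists i, ser 1 (((h i)%:P) ^+ e i) q.
apply: (cost_trans (S := S)).
  apply: cost_exists_ord => i.
  by apply: (@cost_ser_exp _ _ 1 _ (h i)%:P) => // p /serC <-.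
apply: (@cost_subr _ _ _ (ser 1 (\prod_i (h i)%:P ^+ e i))).
  move=> q <-; exists 0%N => //; under eq_bigr do rewrite -polyC_exp.
  by rewrite -rmorph_prod coefC.
by apply: (@cost_ser_prod _ _ 1) => i p Hp; right; exists i.
Qed.

(** * Restriction to pencils of lines *)

Section WeightBounded.

Variable A : comNzRingType.

(** Total degree at most [e] in the outer and the inner variable; truncated subtraction makes the
    coefficients of index above [e] vanish. *)
Definition weight_bounded e (P : {poly {poly A}}) := forall k, (size (P`_k)%R <= e.+1 - k)%N.

Lemma weight_boundedM e e' P P' : weight_bounded e P -> weight_bounded e' P' ->
  weight_bounded (e + e') (P * P').
Proof.
move=> Pe Pe' k; rewrite coefM; apply: leq_trans (size_sum _ _ _) _.
apply/bigmax_leqP => j _; have := ltn_ord j; rewrite ltnS => le_j.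
have [E|nz] := eqVneq (size P`_j) 0%N.
  by rewrite (size_poly_leq0P _ (eq_leq E)) mul0r size_poly0.
have [E|nz'] := eqVneq (size P'`_(k - j)) 0%N.
  by rewrite (size_poly_leq0P _ (eq_leq E)) mulr0 size_poly0.
apply: leq_trans (size_polyMleq _ _) _.
have := Pe j; have := Pe' (k - j)%N; move: nz nz' le_j.
move: (size P`_j) (size P'`_(k - j)) (nat_of_ord j) => x y z; lia.
Qed.

Lemma weight_boundedX e P k : weight_bounded e P -> weight_bounded (e * k) (P ^+ k).
Proof.
move=> Pe; elim: k => [|k IHk]; last by rewrite exprS mulnS; apply: weight_boundedM.
move=> k; rewrite expr0 muln0 coef1; case: k => [|k] /=.
  by rewrite mulr1n size_poly1.
by rewrite mulr0n size_poly0.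
Qed.

Lemma weight_bounded_prod (I : finType) (P : I -> {poly {poly A}}) (m : I -> nat) :
  (forall i, weight_bounded 1 (P i)) ->
  weight_bounded (\sum_i m i) (\prod_i P i ^+ m i).
Proof.
move=> P1; elim/big_rec2: _ => [|i x q _ IH].
  by have := @weight_boundedX 0 0 0; rewrite expr0 muln0; apply => k; rewrite coef0 size_poly0.
by apply: weight_boundedM IH; have := weight_boundedX (m i) (P1 i); rewrite mul1n.
Qed.

Lemma weight_bounded_linear (x y z : A) :
  weight_bounded 1 ((x%:P + y%:P * 'X)%:P + (z%:P)%:P * 'X).
Proof.
move=> j; rewrite coefD coefC coefMX coefC; case: j => [|[|j]] /=.
- rewrite addr0 (leq_trans (size_polyD _ _)) // geq_max.
  rewrite (leq_trans (size_polyC_leq1 _)) //= mul_polyC.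
  by rewrite (leq_trans (size_scale_leq _ _)) // size_polyX.
- by rewrite add0r; apply: size_polyC_leq1.
- by rewrite addr0 size_poly0.
Qed.

End WeightBounded.

Section Substitution.

Variables (F : fieldType) (n : nat).
Local Notation R := {mpoly F[n]}.
Implicit Types (a b : 'I_n -> F) (p : R).

(* [p (a + b y + t (x - a))] as a polynomial in [t] over polynomials in [y]. *)
Definition pencil a b : {rmorphism R -> {poly {poly R}}} :=
  line (polyC \o @mpolyC n F) (fun i => (a i)%:MP%:P + (b i)%:MP%:P * 'X)
    (fun i => ('X_i - (a i)%:MP)%:P).

Definition pencil_at a b (y : F) : {rmorphism R -> {poly R}} :=
  line (@mpolyC n F) (fun i => (a i + b i * y)%:MP) (fun i => 'X_i - (a i)%:MP).

Lemma coef_pencil_at a b y p k :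
  (pencil_at a b y p)`_k = ((pencil a b p)`_k).[y%:MP].
Proof.
have <- : map_poly (horner_eval y%:MP) (pencil a b p) = pencil_at a b y p.
  suff : map_poly (horner_eval y%:MP) \o pencil a b =1 pencil_at a b y by apply.
  apply: eq_mpoly_rmorph => [c|i].
    rewrite -[LHS]/(map_poly (horner_eval y%:MP) (pencil a b c%:MP)).
    by rewrite [pencil _ _ _]lineC [pencil_at _ _ _ _]lineC map_polyC /= /horner_eval hornerC.
  rewrite -[LHS]/(map_poly (horner_eval y%:MP) (pencil a b 'X_i)).
  rewrite [pencil _ _ _]lineX [pencil_at _ _ _ _]lineX rmorphD rmorphM /=.
  rewrite map_polyX !map_polyC /=.
  by rewrite /horner_eval !hornerE mpolyCD mpolyCM.
by rewrite coef_map.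
Qed.

(** The substituted forms have total degree at most one in [y] and [t], so each power of [t] lowers
    the degree left for [y]. For [k > 0] this is the strict inequality that [partial_fractions]
    needs. *)
Lemma size_coef_pencil a b p e k : (msize p <= e.+1)%N ->
  (size ((pencil a b p)`_k)%R <= e.+1 - k)%N.
Proof.
move=> size_p; rewrite [p]mpolyE rmorph_sum coef_sum.
apply: leq_trans (size_sum _ _ _) _; apply/bigmax_leqP_seq => m mp _.
have le_me : (mdeg m <= e)%N by rewrite -ltnS (leq_trans (msize_mdeg_lt mp)).
rewrite -mul_mpolyC rmorphM [pencil a b _%:MP]lineC coefCM.
rewrite mul_polyC (leq_trans (size_scale_leq _ _)) //.
suff bm : weight_bounded (mdeg m) (pencil a b 'X_[m]).
  by apply: leq_trans (bm k) _; apply: leq_sub2r.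
rewrite mpolyXE_id rmorph_prod mdegE.
rewrite (eq_bigr (fun i => pencil a b 'X_i ^+ m i)); last by move=> i _; apply: rmorphXn.
apply: weight_bounded_prod => i; rewrite [pencil a b _]lineX.
exact: weight_bounded_linear.
Qed.

Lemma coef0_pencil_at a b y p : (pencil_at a b y p)`_0 = (line idfun a b p).[y]%:MP.
Proof.
rewrite -horner_coef0.
suff : horner_eval 0 \o pencil_at a b y =1 @mpolyC n F \o (horner_eval y \o line idfun a b).
  by apply.
apply: eq_mpoly_rmorph => [c|i].
  rewrite -[LHS]/(horner_eval 0 (pencil_at a b y c%:MP)).
  rewrite -[RHS]/((horner_eval y (line idfun a b c%:MP))%:MP).
  by rewrite [pencil_at _ _ _ _]lineC lineC /horner_eval !hornerC.
rewrite -[LHS]/(horner_eval 0 (pencil_at a b y 'X_i)).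
rewrite -[RHS]/((horner_eval y (line idfun a b 'X_i))%:MP).
by rewrite [pencil_at _ _ _ _]lineX lineX /horner_eval !hornerE.
Qed.

(** The sum is the value at [t = 1]; with [y = 0], the point [a + t (x - a)] is then [x]. *)
Lemma sum_coef_pencil_at a b p D : (msize p <= D.+1)%N ->
  \sum_(k < D.+1) (pencil_at a b 0 p)`_k = p.
Proof.
move=> size_p.
have [size_l _] := @line_top F n R (@mpolyC n F) (fun i => (a i + b i * 0)%:MP)
  (fun i => 'X_i - (a i)%:MP) p D size_p.
have E : horner_eval (1 : R) (pencil_at a b 0 p) = p.
  suff : horner_eval (1 : R) \o pencil_at a b 0 =1 idfun by apply.
  apply: eq_mpoly_rmorph => [c|i].
    rewrite -[LHS]/(horner_eval 1 (pencil_at a b 0 c%:MP)).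
    by rewrite [pencil_at _ _ _ _]lineC /horner_eval hornerC.
  rewrite -[LHS]/(horner_eval 1 (pencil_at a b 0 'X_i)).
  rewrite [pencil_at _ _ _ _]lineX mulr0 addr0 /horner_eval hornerD hornerM !hornerC.
  by rewrite hornerX mulr1 addrC subrK.
rewrite -[RHS]E /horner_eval (horner_coef_wide _ size_l).
by apply: eq_bigr => k _; rewrite expr1n mulr1.
Qed.

Lemma cost_pencil_at_var a b y D A i :
  cost A (ser D (pencil_at a b y 'X_i)) (D * (3 * D)).
Proof.
rewrite [pencil_at _ _ _ _]lineX; apply: cost_bigunion_indep => k lt_k.
apply: (@cost_leq _ _ _ _ 3); first by lia.
rewrite coefD coefC coefMX coefC; case: k lt_k => [|[|k]] lt_k /=.
- by rewrite addr0; apply: cost_leq (cost_const _ _).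
- rewrite add0r -mpolyCN; apply: (@cost_trans _ _ _ (eq 'X_i) _ 1 2).
    exact/cost_step/step_var.
  apply: (@cost_trans _ _ _ (eq (- a i)%:MP) _ 1 1); first exact: cost_const.
  by apply/cost_step/step_add; [left; right|right].
- by rewrite addr0 -[0]/(0 : R) -(mpolyC0 n F); apply: cost_leq (cost_const _ _).
Qed.

Lemma cost_pencil_at a b y D p m : cost (fun=> False) (eq p) m ->
  cost (fun=> False) (ser D (pencil_at a b y p)) (m * (D * (3 * D))).
Proof.
apply: cost_ser_rmorph => [A i|c]; first exact: cost_pencil_at_var.
exact: lineC.
Qed.

End Substitution.

(** * First-order expansion of a product of powers *)

Section LogExpansion.

Variables (F : fieldType) (n : nat).
Local Notation R := {mpoly F[n]}.
Variable dl : nat.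
Hypothesis dl_gt0 : (0 < dl)%N.

(* [p = q (1 + v t^dl)] modulo [t^dl.+1]. *)
Let perturbed (p q : {poly R}) (w : F) (v : R) :=
  q`_0 = w%:MP /\ exists2 z, p = q + 'X^dl * z & z`_0 = w *: v.

Let perturbed1 : perturbed 1 1 1 0.
Proof.
by split; [rewrite coef1 mpolyC1|exists 0; rewrite ?mulr0 ?addr0 ?scaler0 ?coef0].
Qed.

Let perturbedM p p' q q' w w' v v' : perturbed p q w v -> perturbed p' q' w' v' ->
  perturbed (p * p') (q * q') (w * w') (v + v').
Proof.
move=> [q0 [z -> z0]] [q'0 [z' -> z'0]]; split; first by rewrite coef0M q0 q'0 mpolyCM.
exists (z * q' + q * z' + 'X^dl * (z * z')); first by ring.
rewrite !coefD !coef0M coefXn (ltn_eqF dl_gt0) mul0r addr0 q0 q'0 z0 z'0.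
rewrite [_ * w'%:MP]mulrC !mul_mpolyC !scalerA [w' * w]mulrC scalerDr //.
Qed.

Let perturbedX p q w v e : perturbed p q w v ->
  perturbed (p ^+ e) (q ^+ e) (w ^+ e) (v *+ e).
Proof.
move=> pq; elim: e => [|e IHe]; first by rewrite !expr0 mulr0n; apply: perturbed1.
by rewrite !exprS mulrS; apply: perturbedM.
Qed.

(** Restoring the coefficient of [t^dl] multiplies the truncation of [p i] by [1 + v t^dl], with
    [v = (w i)^-1 *: (p i)_dl]. As [dl > 0], cross terms lie beyond [t^dl], so these perturbations
    add up, with multiplicities [e i]. *)
Lemma coef_prod_expansion (I : finType) (p : I -> {poly R}) (w : I -> F) (e : I -> nat) :
  (forall i, w i != 0) -> (forall i, (p i)`_0 = (w i)%:MP) ->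
  (\prod_i p i ^+ e i)`_dl = (\prod_i take_poly dl (p i) ^+ e i)`_dl +
    (\prod_i w i ^+ e i) *: \sum_i ((e i)%:R / w i) *: (p i)`_dl.
Proof.
move=> w0 p0.
have pP i : perturbed (p i) (take_poly dl (p i)) (w i) ((w i)^-1 *: (p i)`_dl).
  split; first by rewrite coef_take_poly dl_gt0.
  exists (drop_poly dl (p i)); first by rewrite mulrC poly_take_drop.
  by rewrite scalerA divff // scale1r coef_drop_poly.
have [_ [z -> z0]] : perturbed (\prod_i p i ^+ e i) (\prod_i take_poly dl (p i) ^+ e i)
    (\prod_i w i ^+ e i) (\sum_i ((e i)%:R / w i) *: (p i)`_dl).
  elim: (index_enum I) => [|i s IHs]; first by rewrite !big_nil; apply: perturbed1.
  rewrite !big_cons; apply: perturbedM IHs.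
  by rewrite -scalerA scaler_nat; apply: perturbedX.
by rewrite coefD coefXnM ltnn subnn z0.
Qed.

End LogExpansion.

(** * Reconstruction of the irreducible factors *)

Section Reconstruction.

Variables (F : fieldType) (n : nat).
Local Notation R := {mpoly F[n]}.
Variables (k d m : nat) (h : 'I_k -> R) (e : 'I_k -> nat) (lc : F).
Variables (a b : 'I_n -> F) (c : 'I_d -> F).
Hypothesis pcharF0 : [pchar F] =i pred0.
Hypothesis (h_neq0 : forall i, h i != 0).
Hypothesis (sum_deg : (\sum_i (msize (h i)).-1)%N = d).
Hypothesis (e_gt0 : forall i, (0 < e i)%N).
Hypothesis (e_lt : forall i, (e i < 2 ^ m)%N).
Hypothesis (lc_neq0 : lc != 0).
Hypothesis (size_line : forall i, size (line idfun a b (h i)) = msize (h i)).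
Hypothesis (coprime_line : forall i j, i != j ->
  coprimep (line idfun a b (h i)) (line idfun a b (h j))).
Hypothesis (c_inj : injective c).
Hypothesis (line_neq0 : forall i l, (line idfun a b (h i)).[c l] != 0).

Let K := (d.+1 * (3 * d.+1))%N.

(** The points [c l] carry the lifting; the extra point [y = 0] is where [h i] is recovered at the
    end. *)
Definition point (o : option 'I_d) : F := if o is Some l then c l else 0.

Definition branch (io : 'I_k * option 'I_d) := pencil_at a b (point io.2) (h io.1).

Definition target : R := lc%:MP * \prod_i h i ^+ e i.

Definition measured (p : R) := exists l, ser d.+1 (pencil_at a b (c l) target) p.

Definition known dl (p : R) := exists io, ser dl (branch io) p.

Definition step_cost :=
  (1 + (d * ((k * ((2 * m).+1 * K) + k.+1 * K) + 5) + (k * d.+1) * (3 * d).+1))%N.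

Lemma card_branches : #|{: 'I_k * option 'I_d}| = (k * d.+1)%N.
Proof. by rewrite card_prod card_option !card_ord. Qed.

Let logder l dl :=
  \sum_j ((e j)%:R / (line idfun a b (h j)).[c l]) *: (branch (j, Some l))`_dl.

(** In [coef_prod_expansion] one coefficient is measured and the one of the truncated product is
    computable from what is known; their normalized difference is the logarithmic derivative. *)
Lemma cost_logder dl A l : (0 < dl <= d)%N -> (forall p, measured p -> A p) ->
  (forall p, known dl p -> A p) -> A 0 ->
  cost A (eq (logder l dl)) ((k * ((2 * m).+1 * K) + k.+1 * K) + 5).
Proof.
move=> /andP[dl_gt0 dl_le] mA kA A0.
pose q i := take_poly dl (branch (i, Some l)).
have qA i p : ser d.+1 (q i) p -> A p.
  move=> [j lt_j <-]; rewrite coef_take_poly; case: ifP => // lt_jdl.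
  by apply: kA; exists (i, Some l), j.
pose w := \prod_i (line idfun a b (h i)).[c l] ^+ e i.
have w0 : w != 0 by apply/prodf_neq0 => i _; rewrite expf_neq0.
have E : logder l dl = (lc * w)^-1 *: (pencil_at a b (c l) target)`_dl +
    (- w^-1) *: (\prod_i q i ^+ e i)`_dl.
  rewrite /target rmorphM rmorph_prod [pencil_at _ _ _ lc%:MP]lineC coefCM.
  rewrite (eq_bigr (fun i => branch (i, Some l) ^+ e i)); last by move=> i _; apply: rmorphXn.
  rewrite (@coef_prod_expansion _ _ _ dl_gt0 _ (fun i => branch (i, Some l))
    (fun i => (line idfun a b (h i)).[c l])) //; last by move=> i; apply: coef0_pencil_at.
  rewrite -/w -/(logder l dl) mul_mpolyC scalerA.
  rewrite (_ : (lc * w)^-1 * lc = w^-1) ?scalerDr; last by rewrite invfM mulrC mulVKf.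
  by rewrite scalerA mulVf // scale1r scaleNr addrAC subrr add0r.
rewrite E; apply: (cost_trans (S := ser d.+1 (\prod_i q i ^+ e i))); last first.
  apply: cost_lin2; last by right; exists dl.
  by left; apply: mA; exists l, dl.
apply: (cost_trans (S := fun p => exists i, ser d.+1 (q i ^+ e i) p)).
  apply: cost_exists_ord => i.
  by apply: cost_ser_exp => // p; apply: qA.
by apply: cost_ser_prod => i p Hp; right; exists i.
Qed.

Lemma branch_logder io dl : (0 < dl)%N ->
  exists lam, (branch io)`_dl = \sum_l lam l *: logder l dl.
Proof.
case: io => i o dl_gt0.
have [||lam lamP] := @partial_fractions F R (@mpolyC n F) k d
  (fun i => line idfun a b (h i)) (fun i => (msize (h i)).-1) (fun i => (e i)%:R) c
  _ sum_deg coprime_line _ c_inj line_neq0 i (point o).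
- by move=> j; rewrite size_line -mpolySpred.
- by move=> j; have /pcharf0P-> := pcharF0; rewrite -lt0n.
exists lam; rewrite /branch coef_pencil_at /= (lamP (fun j => (pencil a b (h j))`_dl)).
  apply: eq_bigr => l _; rewrite mul_mpolyC; congr (_ *: _).
  by apply: eq_bigr => j _; rewrite mul_mpolyC /branch coef_pencil_at.
move=> j; apply: leq_trans (size_coef_pencil a b (e := (msize (h j)).-1) dl _) _.
  by rewrite -mpolySpred.
by case: (dl) dl_gt0 => // r _; rewrite subSS leq_subr.
Qed.

Lemma cost_known_step dl : (0 < dl <= d)%N ->
  cost (unionp measured (known dl)) (fun p => exists io, eq (branch io)`_dl p) step_cost.
Proof.
move=> dlP; have dl_gt0 : (0 < dl)%N by case/andP: dlP.
(* The truncated branches have zero coefficients from [dl] on, so 0 has to be available. *)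
apply: (cost_trans (cost_const _ 0)).
apply: (cost_trans (S := fun p => exists l, eq (logder l dl) p)).
  apply: cost_exists_ord => l; apply: cost_logder => //.
  - by move=> p; left; left.
  - by move=> p; left; right.
  - by right; rewrite mpolyC0.
rewrite -card_branches; apply: cost_exists => io.
have [lam ->] := branch_logder io dl_gt0.
apply: cost_lincomb => l; right.
by exists l.
Qed.

Lemma cost_known dl : (dl <= d)%N ->
  cost measured (known dl.+1) (k * d.+1 + dl * step_cost).
Proof.
elim: dl => [_|dl IHdl lt_dl].
  rewrite addn0 -card_branches -[X in cost _ _ X]muln1; apply: cost_exists => io.
  apply: (@cost_subr _ _ _ (eq (branch io)`_0)).
    by move=> p [j]; rewrite ltnS leqn0 => /eqP->.
  by rewrite [(branch io)`_0]coef0_pencil_at; apply: cost_const.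
rewrite mulSnr addnA.
apply: (@cost_subr _ _ _ (unionp (known dl.+1) (fun p => exists io, eq (branch io)`_dl.+1 p))).
  move=> p [io [j]]; rewrite ltnS leq_eqVlt => /predU1P[->|lt_j] E.
    by right; exists io.
  by left; exists io, j.
by apply: cost_union (IHdl (ltnW lt_dl)) (cost_known_step _).
Qed.

Lemma cost_factors :
  cost measured (fun p => exists i, eq (h i) p)
    ((k * d.+1 + d * step_cost) + k * d.+2).
Proof.
apply: cost_trans (cost_known (leqnn d)) _.
apply: cost_exists_ord => i.
have size_h : (msize (h i) <= d.+1)%N.
  rewrite mpolySpred // ltnS -sum_deg (bigD1 i) //=; exact: leq_addr.
rewrite -{1}(sum_coef_pencil_at a b size_h).
apply: (@cost_sum_ord _ _ _ d.+1 (fun j => (pencil_at a b 0 (h i))`_j)) => j lt_j.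
by right; exists (i, None), j.
Qed.

End Reconstruction.

(** * Degrees and divisors of a product of powers *)

Section Degrees.

Variables (F : fieldType) (n : nat).
Local Notation R := {mpoly F[n]}.

Lemma leq_msizeM (p q : R) : p != 0 -> q != 0 -> (msize p <= msize (p * q)%R)%N.
Proof.
move=> p0 q0; rewrite msizeM // [msize q]mpolySpred // addnS /=.
exact: leq_addr.
Qed.

Lemma deg_prod k (h : 'I_k -> R) : (forall i, h i != 0) ->
  deg (\prod_i h i) = (\sum_i (msize (h i)).-1)%N.
Proof.
move=> h0; suff : \prod_i h i != 0 /\ deg (\prod_i h i) = (\sum_i (msize (h i)).-1)%N by case.
elim/big_rec2: _ => [|i x p _ [p0 <-]]; first by rewrite oner_eq0 /deg msize1.
rewrite mulf_neq0 //; split=> //; rewrite /deg msizeM //.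
by rewrite [msize (h i)]mpolySpred // [msize p]mpolySpred // addnS.
Qed.

Lemma ltn_msize_exp (p : R) e : mirreducible p -> (e < msize (p ^+ e)%R)%N.
Proof.
move=> [p0 pU _]; elim: e => [|e IHe]; first by rewrite expr0 msize1.
apply: leq_ltn_trans IHe _; rewrite exprSr.
by apply: msize_dvd_lt => //; rewrite expf_neq0.
Qed.

(** Unique factorization: the primes [h i] are cancelled one at a time, each from [p] or from [q],
    until only a scalar is left. *)
Lemma divisor_prod_exp k (h : 'I_k -> R) (e : 'I_k -> nat) (a : F) (p q : R) :
  (forall i, mirreducible (h i)) -> a != 0 ->
  p * q = a%:MP * \prod_i h i ^+ e i ->
  exists (b : F) (e' : 'I_k -> nat),
    p = b%:MP * \prod_i h i ^+ e' i /\ forall i, (e' i <= e i)%N.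
Proof.
move=> hI a0; have [N] := ubnP (\sum_i e i)%N.
elim: N e p q => // N IHN e p q; rewrite ltnS => eN pqE.
have [e0|] := pselect (forall i, e i = 0%N); last first.
  move=> /existsNP[i /eqP]; rewrite -lt0n => ei.
  pose e1 j := (e j - (j == i))%N.
  have prodE (f : 'I_k -> nat) : \prod_j h j ^+ (f j + (j == i)) = h i * \prod_j h j ^+ f j.
    rewrite (bigD1 i) //= eqxx addn1 exprS -mulrA; congr (_ * _).
    rewrite [in RHS](bigD1 i) //=; congr (_ * _); apply: eq_bigr => j /negPf->.
    by rewrite addn0.
  have eE j : e j = (e1 j + (j == i))%N.
    by rewrite /e1; case: eqP => [->|_]; rewrite ?subn0 ?addn0 ?subnK.
  have e1N : (\sum_j e1 j < N)%N.
    apply: leq_trans eN; rewrite [X in (_ < X)%N](eq_bigr _ (fun j _ => eE j)).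
    rewrite big_split /= -[X in (X < _)%N]addn0 ltn_add2l.
    by rewrite (bigD1 i) //= eqxx.
  have {}pqE : p * q = h i * (a%:MP * \prod_j h j ^+ e1 j).
    by rewrite pqE mulrCA -prodE; under eq_bigr do rewrite eE.
  have [hi0 hiP] := mirreducible_prime (hI i).
  have [|[r pE]|[r qE]] := hiP p q; first by exists (a%:MP * \prod_j h j ^+ e1 j).
    have [|b [e' [rE e'e]]] := IHN e1 r q e1N.
      by apply: (mulfI hi0); rewrite mulrA -pE.
    exists b, (fun j => e' j + (j == i))%N; split=> [|j]; last by rewrite eE leq_add2r.
    by rewrite pE rE mulrCA prodE.
  have [|b [e' [pE e'e]]] := IHN e1 p r e1N.
    by apply: (mulfI hi0); rewrite mulrCA -qE.
  by exists b, e'; split=> // j; apply: leq_trans (e'e j) _; apply: leq_subr.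
move: pqE; rewrite big1 ?mulr1 => [pqE|i _]; last by rewrite e0 expr0.
have /munitP[b _ pE] : p \is a GRing.unit.
  have : p * q \is a GRing.unit by rewrite pqE; apply/munitP; exists a.
  by rewrite unitrM => /andP[].
by exists b, (fun=> 0%N); split=> //; rewrite pE big1 ?mulr1.
Qed.

End Degrees.

Lemma poly_nonroots (F : fieldType) (p : {poly F}) d : [pchar F] =i pred0 -> p != 0 ->
  exists2 c : 'I_d -> F, injective c & forall l, p.[c l] != 0.
Proof.
move=> pcharF0 p0.
have [s [size_s uniq_s sP]] : exists s : seq F,
    [/\ size s = d, uniq s & {in s, forall x, p.[x] != 0}].
  elim: d => [|d [s [<- s_uniq sP]]]; first by exists [::].
  have [|x] := @poly_nonroot F pcharF0 (p * \prod_(y <- s) ('X - y%:P)).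
    by rewrite mulf_neq0 // monic_neq0 // monic_prod_XsubC.
  rewrite hornerM mulf_eq0 negb_or -[(\prod_(y <- s) _).[x] == 0]rootE.
  rewrite root_prod_XsubC => /andP[px xs].
  exists (x :: s); split; rewrite /= ?xs // => y; rewrite inE => /predU1P[->//|].
  exact: sP.
exists (fun l => nth 0 s l) => [l l' /eqP|l].
  by rewrite nth_uniq ?size_s // => /eqP/val_inj.
by apply: sP; rewrite mem_nth // size_s.
Qed.

Lemma line_at0 (F : fieldType) n (a b : 'I_n -> F) p : (line idfun a b p).[0] = p.@[a].
Proof.
suff : horner_eval 0 \o line idfun a b =1 meval a by apply.
apply: eq_mpoly_rmorph => [c|i] /=; rewrite /horner_eval.
  by rewrite [mmap _ _ _]lineC hornerC mevalC.
by rewrite [mmap _ _ _]lineX !hornerE mevalXU.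
Qed.

(** * Assembly and the polynomial bound *)

Definition factor_cost s d k :=
  let K := (d.+1 * (3 * d.+1))%N in
  (d * (s * K + s * K + 2 * K) +
    (k * d.+1 + d * step_cost k d s.+1 + k * d.+2 +
      (k * ((2 * s.+1).+1 * 3) + k.+1 * 3 + 2)))%N.

Lemma cost_divisor (F : fieldType) n (f u0 u1 r g : {mpoly F[n]}) s :
  [pchar F] =i pred0 -> f != 0 -> f = u0 * u1 ->
  cost (fun=> False) (eq f) s -> cost (fun=> False) (eq u0) s ->
  is_radical u1 r -> mdvd g u1 ->
  exists2 k, (k <= deg r)%N & cost (fun=> False) (eq g) (factor_cost s (deg r) k).
Proof.
move=> pcharF0 f0 fE costf costu0 [k [h [e [lc [[lc0 u1E] hI e_gt0 hcop rE]]]]] [g' gE].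
have h0 i : h i != 0 by case: (hI i).
have hU i : (0 < (msize (h i)).-1)%N.
  by have [_ /(msize_gt1 (h0 i))] := hI i; case: (msize _) => [|[|]].
exists k.
  rewrite rE deg_prod // -[X in (X <= _)%N]card_ord -sum1_card.
  by apply: leq_sum => i _; apply: hU.
have [b [e' [gb e'e]]] := divisor_prod_exp hI lc0 (etrans (esym gE) u1E).
have /andP[u00 u10] : (u0 != 0) && (u1 != 0) by rewrite -negb_or -mulf_eq0 -fE.
(* The power [h i ^+ e i] divides [f], whose degree is at most [2 ^ s], and [h i] is not
   constant. *)
have e_lt i : (e i < 2 ^ s.+1)%N.
  apply: (@leq_trans (msize f).-1.+1).
    rewrite -mpolySpred //; apply: leq_trans (ltn_msize_exp _ (hI i)) _.
    have [q fq] : exists q, f = h i ^+ e i * q.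
      exists (u0 * lc%:MP * \prod_(j | j != i) h j ^+ e j).
      by rewrite fE u1E (bigD1 i) //=; ring.
    have /andP[x0 q0] : (h i ^+ e i != 0) && (q != 0) by rewrite -negb_or -mulf_eq0 -fq.
    by rewrite fq leq_msizeM.
  have := msize_cost costf; have : (0 < 2 ^ s)%N by rewrite expn_gt0.
  by rewrite expnS; move: (2 ^ s)%N (msize f); lia.
set d := deg r; have sum_deg : (\sum_i (msize (h i)).-1)%N = d by rewrite /d rE deg_prod.
have [x [y [fx size_line coprime_line]]] := good_line pcharF0 hI hcop f0.
(* On the line, [f] is not zero since it does not vanish at the base point. Avoiding its zeros takes
   care both of [u0], by which one divides, and of all the [h i]. *)
have [|c c_inj cP] := @poly_nonroots F (line idfun x y f) d pcharF0.
  by apply: contraNneq fx => E; rewrite -(line_at0 x y) E horner0.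
have u1T : u1 = target h e lc by [].
have cP' l : (line idfun x y u0).[c l] != 0 /\ forall i, (line idfun x y (h i)).[c l] != 0.
  have := cP l; rewrite fE rmorphM hornerM mulf_eq0 negb_or => /andP[? u1c]; split=> // i.
  apply: contraNneq u1c => hic; rewrite u1E rmorphM rmorph_prod (bigD1 i) //= rmorphXn.
  by rewrite !hornerM horner_exp hic expr0n eqn0Ngt e_gt0 mul0r mulr0.
apply: (cost_trans (S := measured h e lc x y c)).
  apply: cost_exists_ord => l; rewrite -u1T.
  apply: (cost_trans (S := unionp (ser d.+1 (pencil_at x y (c l) f))
    (ser d.+1 (pencil_at x y (c l) u0)))).
    apply: cost_union; first exact: cost_pencil_at.
    by apply: cost_mono (cost_pencil_at x y (c l) d.+1 costu0).
  apply: (@cost_ser_div _ _ _ _ (pencil_at x y (c l) u0) _ (line idfun x y u0).[c l]).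
  - by case: (cP' l).
  - exact: coef0_pencil_at.
  - by move=> p; right; right.
  - by move=> p; rewrite -rmorphM -fE; right; left.
apply: (cost_trans (S := fun p => exists i, eq (h i) p)).
  apply: cost_mono (cost_factors pcharF0 h0 sum_deg e_gt0 e_lt lc0 size_line
    coprime_line c_inj (fun i l => (cP' l).2 i)) => // p; by right.
rewrite gb mul_mpolyC.
apply: (cost_trans (S := eq (\prod_i h i ^+ e' i))).
  apply: cost_exp_prod => [i|i]; first exact: leq_ltn_trans (e'e i) (e_lt i).
  by right; exists i.
by apply: cost_scale; right.
Qed.

Section PowerBounds.

Variable Y : nat.
Hypothesis Y_gt1 : (1 < Y)%N.
Implicit Types (a b i j : nat).

Lemma leq_pow_add a b i j l : (i < l)%N -> (j < l)%N ->
  (a <= Y ^ i)%N -> (b <= Y ^ j)%N -> (a + b <= Y ^ l)%N.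
Proof.
case: l => // l; rewrite !ltnS => il jl ai bj.
apply: leq_trans (leq_add (leq_trans ai _) (leq_trans bj _)) _.
- exact: leq_pexp2l (ltnW Y_gt1) il.
- exact: leq_pexp2l (ltnW Y_gt1) jl.
by rewrite addnn -mul2n expnS leq_mul2r Y_gt1 orbT.
Qed.

Lemma leq_pow_mul a b i j : (a <= Y ^ i)%N -> (b <= Y ^ j)%N -> (a * b <= Y ^ (i + j))%N.
Proof. by move=> ai bj; rewrite expnD leq_mul. Qed.

End PowerBounds.

Lemma factor_cost_leq s d k : (1 < s)%N -> (k <= d)%N ->
  (3 * factor_cost s d k <= (s + d) ^ 34)%N.
Proof.
move=> s_gt1 le_kd; pose Y := (s + d + 2)%N.
have Y1 : (1 < Y)%N by rewrite /Y; lia.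
have y x : (x <= Y)%N -> (x <= Y ^ 1)%N by rewrite expn1.
have YM := @leq_pow_mul Y; have YD := @leq_pow_add Y Y1.
(* Products add exponents of [Y] and a sum raises the larger by one, which leads to 17. Since
   [s + d >= 2], [Y = s + d + 2] is at most [(s + d) ^ 2], whence 34. *)
apply: (@leq_trans (Y ^ 17)); last first.
  rewrite (_ : 34%N = (2 * 17)%N) // expnM leq_exp2r // /Y expnS expn1; nia.
have d1 : (d.+1 <= Y ^ 1)%N by apply: y; rewrite /Y; lia.
have d0 : (d <= Y ^ 1)%N by apply: y; rewrite /Y; lia.
have d2 : (d.+2 <= Y ^ 1)%N by apply: y; rewrite /Y; lia.
have k0 : (k <= Y ^ 1)%N by apply: y; rewrite /Y; lia.
have k1 : (k.+1 <= Y ^ 1)%N by apply: y; rewrite /Y; lia.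
have s0 : (s <= Y ^ 1)%N by apply: y; rewrite /Y; lia.
have c3 : (3 <= Y ^ 1)%N by apply: y; rewrite /Y; lia.
have c2 : (2 <= Y ^ 1)%N by apply: y; rewrite /Y; lia.
have c1 : (1 <= Y ^ 1)%N by apply: y; rewrite /Y; lia.
have c5 : (5 <= Y ^ 2)%N by rewrite expnS expn1 /Y; nia.
have m1 : ((2 * s.+1).+1 <= Y ^ 2)%N by rewrite expnS expn1 /Y; nia.
have d3 : ((3 * d).+1 <= Y ^ 2)%N by rewrite expnS expn1 /Y; nia.
rewrite /factor_cost; set K := (d.+1 * (3 * d.+1))%N.
have K3 : (K <= Y ^ 3)%N by apply: (YM _ _ 1%N 2%N) => //; apply: (YM _ _ 1%N 1%N).
have step : (step_cost k d s.+1 <= Y ^ 11)%N.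
  apply: (YD _ _ 1%N 10%N) => //; apply: (YD _ _ 9%N 4%N) => //; last first.
    by apply: (YM _ _ 2%N 2%N) => //; apply: (YM _ _ 1%N 1%N).
  apply: (YM _ _ 1%N 8%N) => //; apply: (YD _ _ 7%N 2%N) => //.
  apply: (YD _ _ 6%N 4%N) => //; last exact: (YM _ _ 1%N 3%N).
  by apply: (YM _ _ 1%N 5%N) => //; apply: (YM _ _ 2%N 3%N).
apply: (YM _ _ 1%N 16%N) => //; apply: (YD _ _ 7%N 15%N) => //.
  apply: (YM _ _ 1%N 6%N) => //; apply: (YD _ _ 5%N 4%N) => //.
    by apply: (YD _ _ 4%N 4%N) => //; apply: (YM _ _ 1%N 3%N).
  exact: (YM _ _ 1%N 3%N).
apply: (YD _ _ 14%N 6%N) => //.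
  apply: (YD _ _ 13%N 2%N) => //; last exact: (YM _ _ 1%N 1%N).
  by apply: (YD _ _ 2%N 12%N) => //; [apply: (YM _ _ 1%N 1%N)|apply: (YM _ _ 1%N 11%N)].
apply: (YD _ _ 5%N 1%N) => //; apply: (YD _ _ 4%N 2%N) => //; last exact: (YM _ _ 1%N 1%N).
by apply: (YM _ _ 1%N 3%N) => //; apply: (YM _ _ 2%N 1%N).
Qed.

Lemma poly_size_gt0 (F : fieldType) n (p : {mpoly F[n]}) : (0 < poly_size p)%N.
Proof.
rewrite /poly_size; case: ex_minnP => m /asboolP[C _ <-] _.
by rewrite addn_gt0; apply/orP; left; apply/card_gt0P; exists (output C).
Qed.

Theorem theorem1p1 :
  exists c : nat,
    forall (F : closedFieldType) (n : nat) (f u0 u1 : {mpoly F[n]}) (s : nat),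
      [pchar F] =i pred0 ->
      f != 0 -> u0 != 0 -> u1 != 0 ->
      f = u0 * u1 ->
      (poly_size f + poly_size u0 <= s)%N ->
      forall r : {mpoly F[n]}, is_radical u1 r ->
      forall g : {mpoly F[n]}, mdvd g u1 ->
      exists2 C : circuit F n,
        computes C g & (circuit_size C <= (s + deg r) ^ c)%N.
Proof.
exists 34%N => F n f u0 u1 s pcharF0 f0 _ _ fE size_s r radr g dvdg.
have f_gt0 := poly_size_gt0 f; have u0_gt0 := poly_size_gt0 u0.
have [||k le_k costg] := @cost_divisor F n f u0 u1 r g s pcharF0 f0 fE _ _ radr dvdg.
- by apply: cost_leq (poly_size_cost f); lia.
- by apply: cost_leq (poly_size_cost u0); lia.
have [C Cg sizeC] := circuit_cost costg.
exists C => //; apply: leq_trans sizeC _.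
by apply: factor_cost_leq => //; lia.
Qed.
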